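(* Let $\mathbf{f}\in\mathcal{S}'(\mathbb{R}^{n},X)$ and let $\phi\in\mathcal{S}(\mathbb{R}^{n})$ be such that $\int_{\mathbb{R}^n}\phi(t)\,dt=1$. Necessary and sufficient conditions for $\mathbf{f}$ to belong to the space $\mathcal{S}'(\mathbb{R}^{n},E)$ are: (i) $F_{\phi}\mathbf{f}(x,y)$ takes values in $E$ for almost all $(x,y)\in\mathbb{R}^{n}\times(0,1]$ and is measurable as an $E$-valued function on $\mathbb{R}^{n}\times(0,1]$; and (ii) there exist constants $k,l\in\mathbb{N}$ and $C>0$ such that $$\left\|F_{\phi}\mathbf{f}(x,y)\right\|\leq C\frac{\left(1+|x|\right)^{l}}{y^{k}}\quad\text{for almost all }(x,y)\in\mathbb{R}^{n}\times(0,1].$$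
   Context: $X$ is a Hausdorff locally convex topological vector space and $E\subset X$ is a Banach space, with norm $\|\cdot\|$, such that the inclusion $E\to X$ is linear and continuous. $\mathbb{N}$ includes $0$. For $Y=E$ or $Y=X$, $\mathcal{S}'(\mathbb{R}^n,Y)$ is the space of continuous linear maps $\mathcal{S}(\mathbb{R}^n)\to Y$, so $\mathcal{S}'(\mathbb{R}^n,E)\subset\mathcal{S}'(\mathbb{R}^n,X)$. The $\phi$-transform is $F_\phi\mathbf{f}(x,y)=\langle\mathbf{f}(x+yt),\phi(t)\rangle=\langle\mathbf{f}(t),y^{-n}\phi((t-x)/y)\rangle$, $x\in\mathbb{R}^n$, $y>0$. Measurability of $E$-valued functions is in the sense of Bochner (a.e. pointwise limits of $E$-valued continuous functions). *)

(* Defs.v *)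
From HB Require Import structures.
From mathcomp Require Import all_boot all_order all_algebra.
From mathcomp Require Import complex lra.
From mathcomp Require Import all_classical all_reals all_analysis.

Set Implicit Arguments.
Unset Strict Implicit.
Unset Printing Implicit Defensive.

Import Order.TTheory GRing.Theory Num.Theory.
Import numFieldTopology.Exports numFieldNormedType.Exports.

Local Open Scope classical_set_scope.
Local Open Scope ring_scope.

Section measurable_row.
Context (R : realType) (n : nat).

Definition row_coord (i : 'I_n) (t : 'rV[R]_n) : R := t ord0 i.

Let row_set0 : g_sigma_preimage row_coord set0.
Proof. exact: sigma_algebra0. Qed.

Let row_setC A : g_sigma_preimage row_coord A ->
  g_sigma_preimage row_coord (~` A).
Proof. exact: sigma_algebraC. Qed.

Let row_bigcup (F : (set 'rV[R]_n)^nat) :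
  (forall i, g_sigma_preimage row_coord (F i)) ->
  g_sigma_preimage row_coord (\bigcup_i F i).
Proof. exact: sigma_algebra_bigcup. Qed.

HB.instance Definition _ := @isMeasurable.Build default_measure_display
  'rV[R]_n (g_sigma_preimage row_coord) row_set0 row_setC row_bigcup.

Lemma measurable_row_coord (i : 'I_n) : measurable_fun setT (row_coord i).
Proof.
move=> _ Y mY; rewrite setTI; apply: sub_sigma_algebra => /=.
rewrite -bigcup_seq/=; exists i => /=; first by rewrite mem_index_enum.
by exists Y => //; rewrite setTI.
Qed.

Lemma measurable_fun_row d (T : measurableType d) (f : T -> 'rV[R]_n) :
  (forall i, measurable_fun setT (row_coord i \o f)) -> measurable_fun setT f.
Proof.
move=> mf _ A mA; rewrite setTI; move: A mA.
suff H : <<s \big[setU/set0]_(i < n)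
    preimage_set_system setT (row_coord i) measurable >> `<=`
    [set A | measurable (f @^-1` A)] by move=> A /H.
apply: smallest_sub.
  split => /=.
  - by rewrite preimage_set0.
  - by move=> A mA; rewrite setTD preimage_setC; exact: measurableC.
  - by move=> F mF; rewrite preimage_bigcup; exact: bigcupT_measurable.
rewrite -bigcup_seq => A [i _] [B mB <-]/=; rewrite setTI.
by rewrite -comp_preimage -[X in measurable X]setTI; exact: mf.
Qed.

End measurable_row.

Section lebesgue_row.
Context (R : realType).

Definition row_cons n (p : R * 'rV[R]_n) : 'rV[R]_n.+1 := row_mx p.1%:M p.2.

Definition row_uncons n (t : 'rV[R]_n.+1) : R * 'rV[R]_n :=
  (t ord0 ord0, @rsubmx _ 1 1 n t).

Lemma row_consK n : cancel (@row_cons n) (@row_uncons n).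
Proof.
move=> [a v]; rewrite /row_uncons /row_cons/= row_mxKr; congr pair.
have -> : ord0 = lshift n (ord0 : 'I_1) :> 'I_n.+1 by exact: val_inj.
by rewrite (@row_mxEl R 1 1 n) mxE eqxx mulr1n.
Qed.

Lemma measurable_row_cons n : measurable_fun setT (@row_cons n).
Proof.
apply: measurable_fun_row => i; case: (split_ordP (i : 'I_(1 + n))) => j ij.
  rewrite (_ : _ \o _ = fst) ?measurable_fst//; apply/funext => -[a v]/=.
  by rewrite /row_coord /row_cons ij (@row_mxEl R 1 1 n) (ord1 j) mxE eqxx mulr1n.
rewrite (_ : _ \o _ = row_coord j \o snd); last first.
  by apply/funext => -[a v]/=; rewrite /row_coord /row_cons ij (@row_mxEr R 1 1 n).
by apply: measurableT_comp => //; exact: measurable_row_coord.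
Qed.

Lemma measurable_row_uncons n : measurable_fun setT (@row_uncons n).
Proof.
apply/measurable_fun_pairP; split.
  exact: (@measurable_row_coord R n.+1 ord0).
apply: measurable_fun_row => i.
rewrite (_ : _ \o _ = @row_coord R n.+1 (rshift 1 i)).
  exact: measurable_row_coord.
by apply/funext => t; rewrite /row_coord /= mxE.
Qed.

Section step.
Context n (mu : {sigma_finite_measure set 'rV[R]_n -> \bar R}).

Definition lebesgue_step : set 'rV[R]_n.+1 -> \bar R :=
  pushforward (lebesgue_measure \x mu)%E (@row_cons n).

Let lebesgue_step0 : lebesgue_step set0 = 0%E.
Proof. by rewrite /lebesgue_step /pushforward preimage_set0 measure0. Qed.

Let lebesgue_step_ge0 A : (0 <= lebesgue_step A)%E.
Proof. by rewrite /lebesgue_step /pushforward measure_ge0. Qed.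

Let lebesgue_step_sigma_additive : semi_sigma_additive lebesgue_step.
Proof.
exact: (@measure_semi_sigma_additive _ _ _
  (measure_function_pushforward__canonical__measure_function_Measure
     (lebesgue_measure \x mu)%E (@measurable_row_cons n))).
Qed.

HB.instance Definition _ := isMeasure.Build _ _ _ lebesgue_step
  lebesgue_step0 lebesgue_step_ge0 lebesgue_step_sigma_additive.

Let lebesgue_step_sigma_finite : sigma_finite setT lebesgue_step.
Proof.
have /sigma_finiteP[F [TF ndF Foo]] := sigma_finiteT (@lebesgue_measure R).
have /sigma_finiteP[G [TG ndG Goo]] := sigma_finiteT mu.
exists (fun k => @row_uncons n @^-1` (F k `*` G k)).
  rewrite -preimage_bigcup [X in _ @^-1` X](_ : _ = setT) ?preimage_setT//.
  apply/seteqP; split => // -[x y] _.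
  have : [set: R] x by []. rewrite TF => -[i _ Fix].
  have : [set: 'rV[R]_n] y by []. rewrite TG => -[j _ Gjy].
  exists (maxn i j) => //; split => /=.
    by move: x Fix; exact/subsetPset/ndF/leq_maxl.
  by move: y Gjy; exact/subsetPset/ndG/leq_maxr.
move=> k; have [mF Fk] := Foo k; have [mG Gk] := Goo k; split.
  rewrite -[X in measurable X]setTI; apply: measurable_row_uncons => //.
  exact: measurableX.
rewrite /lebesgue_step /pushforward -comp_preimage.
rewrite (_ : _ \o _ = id); last by apply/funext => p; exact: row_consK.
by rewrite preimage_id product_measure1E// lte_mul_pinfty// ge0_fin_numE.
Qed.

HB.instance Definition _ := Measure_isSigmaFinite.Build _ _ _
  lebesgue_step lebesgue_step_sigma_finite.

End step.

(* Lebesgue measure on R^n: the image of the product of the Lebesgue measures on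
   R and R^(n-1) under [row_cons]; for n = 0 it is the Dirac mass *)
Fixpoint lebesgue_row n : {sigma_finite_measure set 'rV[R]_n -> \bar R} :=
  match n with
  | 0 => \d_ (0 : 'rV[R]_0)
  | m.+1 => lebesgue_step (lebesgue_row m)
  end.

End lebesgue_row.

Section schwartz_functions.
Context (R : realType) (n : nat).
Implicit Types (f g : 'rV[R]_n -> R[i]) (x : 'rV[R]_n) (s : seq 'I_n).

(* the Euclidean norm; the library norm on ['rV[R]_n] is the maximum norm *)
Definition enorm x : R := Num.sqrt (\sum_i x ord0 i ^+ 2).

(* the library has no derivative for a complex-valued function of real variables,
   hence the split into real and imaginary parts *)
Definition pderiv (i : 'I_n) f : 'rV[R]_n -> R[i] := fun x =>
  ('D_(delta_mx ord0 i) (@complex.Re R \o f) x +i*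
   'D_(delta_mx ord0 i) (@complex.Im R \o f) x)%C.

(* [pderivs [:: i1; ...; ik] f] is d_i1 ... d_ik f: lists of directions play the
   role of multi-indices *)
Definition pderivs s f : 'rV[R]_n -> R[i] := foldr pderiv f s.

Definition cdifferentiable f x :=
  differentiable (@complex.Re R \o f) x /\
  differentiable (@complex.Im R \o f) x.

(* differentiability of all the partial derivatives of all orders amounts to their
   existence and continuity *)
Definition smooth f := forall s x, cdifferentiable (pderivs s f) x.

Definition weighted (k : nat) s f x : R :=
  (1 + enorm x) ^+ k * Normc.normc (pderivs s f x).

Definition is_schwartz f :=
  smooth f /\ forall k s, exists M : R, forall x, weighted k s f x <= M.

Lemma enorm_ge0 x : 0 <= enorm x. Proof. exact: sqrtr_ge0. Qed.

Lemma ler_coord_enorm x i : `|x ord0 i| <= enorm x.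
Proof.
rewrite -sqrtr_sqr ler_wsqrtr// (bigD1 i)//= lerDl.
by apply: sumr_ge0 => j _; exact: sqr_ge0.
Qed.

Lemma enorm_le_sum x : enorm x <= \sum_i `|x ord0 i|.
Proof.
have S0 : 0 <= \sum_i `|x ord0 i| by exact: sumr_ge0.
rewrite -(ger0_norm S0) -sqrtr_sqr ler_wsqrtr//.
rewrite [leRHS]expr2 mulr_suml ler_sum// => i _.
rewrite -real_normK ?num_real// expr2.
by rewrite ler_wpM2l// (bigD1 i)//= lerDl sumr_ge0.
Qed.

Lemma weighted_ge0 k s f x : 0 <= weighted k s f x.
Proof.
rewrite mulr_ge0 ?exprn_ge0 ?addr_ge0 ?enorm_ge0//.
by case: (pderivs s f x) => a b; exact: sqrtr_ge0.
Qed.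

Lemma weightedD k s f g h x : pderivs s h x = pderivs s f x + pderivs s g x ->
  weighted k s h x <= weighted k s f x + weighted k s g x.
Proof.
move=> sh; rewrite /weighted sh -mulrDr ler_wpM2l//; last exact: le_normcD.
by rewrite exprn_ge0 ?addr_ge0 ?enorm_ge0.
Qed.

Lemma weightedZ k s f h a x : pderivs s h x = a * pderivs s f x ->
  weighted k s h x = Normc.normc a * weighted k s f x.
Proof. by move=> sh; rewrite /weighted sh Normc.normcM mulrCA. Qed.

Let ReZD (a : R[i]) f g : @complex.Re R \o (a *: f + g) =
  complex.Re a *: (@complex.Re R \o f) - complex.Im a *: (@complex.Im R \o f)
  + (@complex.Re R \o g).
Proof.
apply/funext => x; rewrite !fctE /=.
by case: a (f x) (g x) => [a b] [c d] [e h].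
Qed.

Let ImZD (a : R[i]) f g : @complex.Im R \o (a *: f + g) =
  complex.Re a *: (@complex.Im R \o f) + complex.Im a *: (@complex.Re R \o f)
  + (@complex.Im R \o g).
Proof.
apply/funext => x; rewrite !fctE /=.
by case: a (f x) (g x) => [a b] [c d] [e h].
Qed.

Lemma cdifferentiableZD (a : R[i]) f g x :
  cdifferentiable f x -> cdifferentiable g x ->
  cdifferentiable (a *: f + g) x.
Proof.
move=> [fr fi] [gr gi]; rewrite /cdifferentiable ReZD ImZD; split.
  apply: differentiableD gr; apply: differentiableB.
    exact: differentiableZ fr.
  exact: differentiableZ fi.
apply: differentiableD gi; apply: differentiableD.
  exact: differentiableZ fi.
exact: differentiableZ fr.
Qed.

Lemma pderivZD i (a : R[i]) f g :
  (forall x, cdifferentiable f x) -> (forall x, cdifferentiable g x) ->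
  pderiv i (a *: f + g) = a *: pderiv i f + pderiv i g.
Proof.
move=> df dg; apply/funext => x; rewrite /pderiv ReZD ImZD.
have [/diff_derivable fr /diff_derivable fi] := df x.
have [/diff_derivable gr /diff_derivable gi] := dg x.
rewrite !fctE.
rewrite deriveD//; last by apply: derivableB; exact: derivableZ.
rewrite deriveB; [|exact: derivableZ..].
rewrite deriveD//; last by apply: derivableD; exact: derivableZ.
rewrite deriveD; [|exact: derivableZ..].
by rewrite !deriveZ//; case: a.
Qed.

Lemma pderivsZD s (a : R[i]) f g : smooth f -> smooth g ->
  pderivs s (a *: f + g) = a *: pderivs s f + pderivs s g.
Proof.
move=> sf sg; elim: s => // i s IH.
rewrite -[pderivs _ _]/(pderiv i (pderivs s (a *: f + g))) IH.
by rewrite pderivZD.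
Qed.

Lemma smooth0 : smooth (0 : 'rV[R]_n -> R[i]).
Proof.
suff p0 s : pderivs s 0 = 0.
  by move=> s x; rewrite p0; split; exact: differentiable_cst.
elim: s => // i s IH; rewrite -[LHS]/(pderiv i (pderivs s 0)) IH.
apply/funext => x; rewrite /pderiv.
have -> : @complex.Re R \o (0 : 'rV[R]_n -> R[i]) = cst 0 by exact/funext.
have -> : @complex.Im R \o (0 : 'rV[R]_n -> R[i]) = cst 0 by exact/funext.
by rewrite derive_cst.
Qed.

Lemma pderivs0 s : pderivs s (0 : 'rV[R]_n -> R[i]) = 0.
Proof.
have := @pderivsZD s (-1) 0 0 smooth0 smooth0.
by rewrite scaler0 addr0 scaleN1r addNr.
Qed.

Lemma cdifferentiableZ (a : R[i]) f x :
  cdifferentiable f x -> cdifferentiable (a *: f) x.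
Proof.
by move=> df; have := cdifferentiableZD a df (smooth0 [::] x); rewrite addr0.
Qed.

Lemma pderivZ i (a : R[i]) f : (forall x, cdifferentiable f x) ->
  pderiv i (a *: f) = a *: pderiv i f.
Proof.
move=> df; have := pderivZD i a df (smooth0 [::]).
by rewrite (pderivs0 [:: i] : pderiv i 0 = 0) !addr0.
Qed.

Lemma pderivsZ s (a : R[i]) f : smooth f ->
  pderivs s (a *: f) = a *: pderivs s f.
Proof.
move=> sf; have := @pderivsZD s a f 0 sf smooth0.
by rewrite pderivs0 !addr0.
Qed.

Lemma is_schwartz_submod : submod_closed (mem [set f | is_schwartz f]).
Proof.
split.
  apply/mem_set; split; first exact: smooth0.
  move=> k s; exists 0 => x; rewrite /weighted pderivs0.
  by rewrite Normc.normc0 mulr0.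
move=> a f g /set_mem[sf df] /set_mem[sg dg]; apply/mem_set; split.
  by move=> s x; rewrite pderivsZD//; exact: cdifferentiableZD.
move=> k s; have [Mf HMf] := df k s; have [Mg HMg] := dg k s.
exists (Normc.normc a * Mf + Mg) => x.
rewrite (le_trans (@weightedD k s (a *: f) g _ x _))//.
  by rewrite pderivsZD// pderivsZ.
rewrite lerD// (@weightedZ k s f _ a); last by rewrite pderivsZ.
by rewrite ler_wpM2l//; case: a => a b; exact: sqrtr_ge0.
Qed.

End schwartz_functions.

Section schwartz_space.
Context (R : realType) (n : nat).

Definition schwartz_pred : {pred 'rV[R]_n -> R[i]} :=
  mem [set f | is_schwartz f].

HB.instance Definition _ := GRing.isSubmodClosed.Build R[i]
  ('rV[R]_n -> R[i]) schwartz_pred (@is_schwartz_submod R n).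

Record schwartz := Schwartz {
  schwartz_fun :> 'rV[R]_n -> R[i] ;
  schwartz_funP : schwartz_fun \in schwartz_pred }.

HB.instance Definition _ := [isSub for schwartz_fun].
HB.instance Definition _ := [Choice of schwartz by <:].
HB.instance Definition _ := [SubChoice_isSubLmodule of schwartz by <:].

Implicit Types (phi psi : schwartz) (k : nat) (s : seq 'I_n).

Lemma schwartzP phi : is_schwartz phi.
Proof. exact: set_mem (schwartz_funP phi). Qed.

Definition schwartz_seminorm k s phi : R := sup (range (weighted k s phi)).

Lemma weighted_le_seminorm k s phi x :
  weighted k s phi x <= schwartz_seminorm k s phi.
Proof.
apply: sup_upper_bound; last by exists x.
split; first by exists (weighted k s phi x), x.
by have [_ /(_ k s)[M HM]] := schwartzP phi; exists M => _ [y _ <-].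
Qed.

Lemma seminorm_le k s phi M :
  (forall x, weighted k s phi x <= M) -> schwartz_seminorm k s phi <= M.
Proof.
move=> HM; apply: ge_sup; first by exists (weighted k s phi 0), 0.
by move=> _ [y _ <-].
Qed.

Lemma seminormD k s phi psi : schwartz_seminorm k s (phi + psi) <=
  schwartz_seminorm k s phi + schwartz_seminorm k s psi.
Proof.
apply: seminorm_le => x.
apply: le_trans (lerD (weighted_le_seminorm _ _ _ _)
                      (weighted_le_seminorm _ _ _ _)).
apply: weightedD.
have [sphi _] := schwartzP phi; have [spsi _] := schwartzP psi.
by have := @pderivsZD _ _ s 1 _ _ sphi spsi; rewrite !scale1r => ->.
Qed.

Lemma seminorm0 k s : schwartz_seminorm k s 0 = 0.
Proof.
have w0 x : weighted k s (0 : schwartz) x = 0.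
  by rewrite /weighted pderivs0 Normc.normc0 mulr0.
apply/eqP; rewrite eq_le; apply/andP; split.
  by apply: seminorm_le => x; rewrite w0.
by rewrite -(w0 0) weighted_le_seminorm.
Qed.

(* the locally convex topology generated by the family of seminorms
   [schwartz_seminorm k s] *)
Definition schwartz_ball phi (F : seq (nat * seq 'I_n)) (e : R) :
    set schwartz :=
  [set psi | forall k s, (k, s) \in F ->
    schwartz_seminorm k s (psi - phi) < e].

Definition schwartz_nbhs phi : set_system schwartz :=
  [set A | exists F, exists2 e : R, 0 < e & schwartz_ball phi F e `<=` A].

HB.instance Definition _ := hasNbhs.Build schwartz schwartz_nbhs.

Let ball_center phi F (e : R) : 0 < e -> schwartz_ball phi F e phi.
Proof. by move=> e0 k s _; rewrite subrr seminorm0. Qed.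

Let schwartz_nbhs_filter phi : ProperFilter (nbhs phi).
Proof.
split.
  by move=> [F [e e0 /(_ phi)]]; apply; exact: ball_center.
split.
- by exists [::], 1.
- move=> A B [F [e e0 FA]] [G [d d0 GB]].
  exists (F ++ G), (Num.min e d); first by rewrite lt_min e0.
  move=> psi H; split.
    apply: FA => k s ks; have := H k s.
    by rewrite mem_cat ks lt_min => /(_ isT)/andP[].
  apply: GB => k s ks; have := H k s.
  by rewrite mem_cat ks orbT lt_min => /(_ isT)/andP[].
- by move=> A B AB [F [e e0 FA]]; exists F, e => //; exact: subset_trans FA AB.
Qed.

Let schwartz_nbhs_singleton phi (A : set schwartz) : nbhs phi A -> A phi.
Proof. by move=> [F [e e0]]; apply; exact: ball_center. Qed.

Let schwartz_nbhs_nbhs phi (A : set schwartz) :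
  nbhs phi A -> nbhs phi (nbhs^~ A).
Proof.
move=> [F [e e0 FA]]; exists F, (e / 2); first by rewrite divr_gt0.
move=> psi Hpsi; exists F, (e / 2); first by rewrite divr_gt0.
move=> chi Hchi; apply: FA => k s ks.
rewrite (_ : chi - phi = (chi - psi) + (psi - phi)); last by rewrite subrKA.
by rewrite (le_lt_trans (seminormD _ _ _ _))// (splitr e) ltrD ?Hchi ?Hpsi.
Qed.

HB.instance Definition _ := Nbhs_isNbhsTopological.Build schwartz
  schwartz_nbhs_filter schwartz_nbhs_singleton schwartz_nbhs_nbhs.

End schwartz_space.

Section dilation.
Context (R : realType) (n : nat).
Implicit Types (f : 'rV[R]_n -> R[i]) (x t : 'rV[R]_n) (y : R).

Definition affine x y t : 'rV[R]_n := y^-1 *: (t - x).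

Let differentiable_affine x y t : differentiable (affine x y) t.
Proof.
apply: (@differentiableZ _ _ _ (fun t => t - x)).
by apply: (@differentiableB _ _ _ id (cst x)).
Qed.

Let derive_affine x y t (h : 'rV[R]_n -> R) v :
  differentiable h (affine x y t) ->
  'D_v (h \o affine x y) t = y^-1 * 'D_v h (affine x y t).
Proof.
move=> dh; have da := differentiable_affine x y t.
have di : derivable (id : 'rV[R]_n -> 'rV[R]_n) t v by exact: derivable_id.
have dc : derivable (cst x : 'rV[R]_n -> 'rV[R]_n) t v.
  exact: derivable_cst.
have dA : 'd (affine x y) t v = y^-1 *: v.
  rewrite -(deriveE v da).
  have -> : affine x y = y^-1 *: (id - cst x) by [].
  rewrite deriveZ; last exact: (derivableB di dc).
  by rewrite (deriveB di dc) derive_id derive_cst subr0.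
have e := congr1 (@^~ v) (diff_comp da dh).
apply: (etrans (deriveE v (differentiable_comp da dh))).
apply: (etrans e).
by rewrite /= dA (deriveE v dh) linearZ.
Qed.

Lemma pderivs_affine x y s f : smooth f -> pderivs s (f \o affine x y) =
  ((y^-1) ^+ size s)%:C%C *: (pderivs s f \o affine x y).
Proof.
move=> sf; elim: s => [|i s IH].
  by rewrite expr0 scale1r.
rewrite -[LHS]/(pderiv i (pderivs s (f \o affine x y))) IH.
have da t : cdifferentiable (pderivs s f \o affine x y) t.
  have [dr di] := sf s (affine x y t).
  by split; rewrite compA; exact: differentiable_comp.
rewrite (pderivZ _ _ da) exprSr rmorphM -scalerA.
apply: (congr1 (fun g => _ *: g)); apply/funext => t.
have [dr di] := sf s (affine x y t).
have Er := derive_affine (delta_mx ord0 i) dr.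
have Ei := derive_affine (delta_mx ord0 i) di.
apply: (etrans (congr2 (@Complex R) Er Ei)).
by rewrite fctE /= /pderiv /= /GRing.scale/=; simpc.
Qed.

Lemma is_schwartz_affine x y f : 0 < y -> is_schwartz f ->
  is_schwartz (f \o affine x y).
Proof.
move=> y0 [sf df]; split.
  move=> s t; rewrite pderivs_affine//; apply: cdifferentiableZ.
  have [dr di] := sf s (affine x y t).
  by split; rewrite compA; exact: differentiable_comp.
move=> k s; have [M HM] := df k s.
set K := 1 + \sum_i `|x ord0 i| + y *+ n.
have K0 : 0 <= K by rewrite !addr_ge0 ?sumr_ge0 ?mulrn_wge0// ltW.
have tK t : 1 + enorm t <= K * (1 + enorm (affine x y t)).
  set z := affine x y t.
  have tE i : t ord0 i = x ord0 i + y * z ord0 i.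
    by rewrite /z /affine !mxE mulrA divff ?gt_eqF// mul1r; lra.
  have S0 : 0 <= \sum_i `|x ord0 i| by exact: sumr_ge0.
  have : enorm t <= \sum_i `|x ord0 i| + y *+ n * enorm z.
    rewrite (le_trans (enorm_le_sum _))//.
    rewrite mulrnAl -[X in _ *+ X]card_ord -sumr_const -big_split/=.
    apply: ler_sum => i _; rewrite tE (le_trans (ler_normD _ _))// lerD2l.
    by rewrite normrM gtr0_norm// ler_pM2l// ler_coord_enorm.
  have := enorm_ge0 z; have yn0 : 0 <= y *+ n by rewrite mulrn_wge0// ltW.
  have : 0 <= (\sum_i `|x ord0 i|) * enorm z by rewrite mulr_ge0 ?enorm_ge0.
  by rewrite /K !mulrDl !mulrDr !mul1r !mulr1; lra.
clearbody K; set c := ((y^-1) ^+ size s)%:C%C.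
exists (Normc.normc c * (K ^+ k * M)) => t.
rewrite /weighted pderivs_affine// !fctE /= Normc.normcM mulrCA.
have n0 (u : R[i]) : 0 <= Normc.normc u by case: u => a b; exact: sqrtr_ge0.
rewrite ler_wpM2l//; apply: le_trans (_ : K ^+ k * weighted k s f (affine x y t) <= _).
  rewrite /weighted mulrA -exprMn ler_wpM2r//.
  by rewrite lerXn2r ?nnegrE ?mulr_ge0 ?addr_ge0 ?enorm_ge0.
by rewrite ler_wpM2l// exprn_ge0.
Qed.

(* t |-> phi ((t - x) / y), see [sdilateE]; it is only meaningful for 0 < y *)
Definition sdilate x y (phi : schwartz R n) : schwartz R n :=
  insubd 0 (phi \o affine x y).

Lemma sdilateE x y phi t : 0 < y -> sdilate x y phi t = phi (y^-1 *: (t - x)).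
Proof.
move=> y0; rewrite -[LHS]/(val (sdilate x y phi) t) insubdK//.
by apply/mem_set/is_schwartz_affine => //; exact: schwartzP.
Qed.

End dilation.

Definition phi_transform (R : realType) (n : nat) (Y : lmodType R[i])
    (f : schwartz R n -> Y) (phi : schwartz R n) (p : 'rV[R]_n * R) : Y :=
  f ((p.2^-1 ^+ n)%:C%C *: sdilate p.1 p.2 phi).

Definition cintegral (R : realType) (n : nat) (phi : 'rV[R]_n -> R[i]) : R[i] :=
  (\int[lebesgue_row R n]_t complex.Re (phi t) +i*
   \int[lebesgue_row R n]_t complex.Im (phi t))%C.

(* R^n x (0,1] *)
Definition strip (R : realType) (n : nat) : set ('rV[R]_n * R) :=
  [set p | 0 < p.2 <= 1].

Definition ae_strip (R : realType) (n : nat) (P : 'rV[R]_n * R -> Prop) : Prop :=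
  {ae (lebesgue_row R n \x lebesgue_measure)%E, forall p, strip p -> P p}.

(* Bochner measurability on R^n x (0,1]: [G] is a.e. the pointwise limit of a
   sequence of continuous functions with values in [E] *)
Definition strip_measurable (R : realType) (n : nat) (E : normedModType R[i])
    (G : 'rV[R]_n * R -> E) : Prop :=
  exists2 g : nat -> 'rV[R]_n * R -> E,
    forall j, {within @strip R n, continuous (g j)} &
    ae_strip (fun p => g j p @[j --> \oo] --> G p).

(* [into iota v] is [v] seen as an element of [E], for [iota : E -> X]
   injective and [v] in its range; it is [0] outside of the range *)
Definition into (K : numFieldType) (E X : lmodType K) (iota : E -> X) (v : X) :
    E := xget 0 [set e | iota e = v].

(* [f], a continuous linear map into [X], is an element of S'(R^n, E), [E]
   being identified with a subspace of [X] through [iota] *)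
Definition tempered_in (R : realType) (n : nat) (X : tvsType R[i])
    (E : normedModType R[i]) (iota : E -> X) (f : schwartz R n -> X) : Prop :=
  exists2 g : {linear schwartz R n -> E}, continuous g & f = iota \o g.

(* Main.v *)
Require Import Defs.
From HB Require Import structures.
From mathcomp Require Import all_boot all_order all_algebra.
From mathcomp Require Import complex ring lra.
From mathcomp Require Import all_classical all_reals all_analysis.
From mathcomp Require Import measurable_realfun.

Set Implicit Arguments.
Unset Strict Implicit.
Unset Printing Implicit Defensive.

Import Order.TTheory GRing.Theory Num.Theory.
Import numFieldTopology.Exports numFieldNormedType.Exports.

Local Open Scope classical_set_scope.
Local Open Scope ring_scope.

(* Necessity: the wave packets phi_(x,y) = y^-n phi ((. - x) / y) depend continuously
   on (x, y) and have Schwartz seminorms bounded by C (1 + |x|)^l y^-k.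

   Sufficiency: write phi_y * rho as a limit of Riemann sums, in two ways.  As an
   average of translates of rho it shows that rho |-> rho - phi_y * rho is bounded,
   uniformly in y, for every Schwartz seminorm, and is O(y) if one derivative is
   lost.  As a combination of wave packets it shows that f (phi_y * rho) is a limit of
   values of f with norms in E at most C y^-k p(rho), where p is a seminorm.  Put
   rho_0 = rho and rho_(j+1) = rho_j - phi_(y_j) * rho_j, with scales y_j that decrease
   fast, each of them repeated 2k + 1 times.  The terms phi_(y_j) * rho_j add up to rho
   in the Schwartz space and the costs y_j^-k p(rho_j) are summable with a sum bounded
   by a fixed seminorm of rho.  Hence rho is a limit of finite combinations psi of wave
   packets for which f psi lies in E with norm at most C P(rho), and a geometric series
   of such approximations gives f rho in E with norm at most C P(rho) + 3.  By
   homogeneity, f is continuous into E.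

   The nodes (x, y) can be moved to nearby points where (i) and (ii) hold, since such
   points are dense.  The two Riemann sums of phi_y * rho are compared in the Schwartz
   topology by interpolation: they are bounded in it and uniformly close. *)

(** * Lebesgue measure on row vectors *)

Section rational_grid.
Context (R : realType) (n : nat).

Definition rat_point (i : nat) : 'rV[R]_n :=
  map_mx ratr (odflt 0 (unpickle i) : 'rV[rat]_n).

Lemma ball_row (x t : 'rV[R]_n) (e : R) : 0 < e ->
  ball x e t <-> forall j, `|x ord0 j - t ord0 j| < e.
Proof.
move=> e0; split; first by move=> [_ H] j; exact: H.
by move=> H; split => // i j; rewrite ord1; exact: H.
Qed.

Lemma rat_point_dense (x : 'rV[R]_n) (e : R) : 0 < e ->
  exists i, ball (rat_point i) e x.
Proof.
move=> e0.
have /choice[q qP] (j : 'I_n) : exists q : rat, `|ratr q - x ord0 j| < e.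
  have /rat_in_itvoo[q] : x ord0 j - e < x ord0 j + e by lra.
  by rewrite in_itv/= => qj; exists q; rewrite ltr_norml; lra.
exists (pickle (\row_j q j)); rewrite /rat_point pickleK/=.
by apply/ball_row => // j; rewrite !mxE; exact: qP.
Qed.

Lemma measurable_ball_row (x : 'rV[R]_n) (e : R) : 0 < e -> measurable (ball x e).
Proof.
move=> e0; rewrite (_ : ball x e =
  \big[setI/setT]_(j < n) (@row_coord R n j @^-1` (ball (x ord0 j) e))); last first.
  rewrite -bigcap_seq; apply/seteqP; split => t /=.
    by move=> /ball_row H j _; exact: H.
  by move=> H; apply/ball_row => // j; apply: H; rewrite /= mem_index_enum.
apply: bigsetI_measurable => j _.
rewrite -[X in measurable X]setTI; apply: measurable_row_coord => //.
by apply: open_measurable; exact: ball_open.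
Qed.

(** The sigma-algebra is generated by the coordinates. Rational balls of radius 1/(k+1) are finite
    intersections of coordinate conditions, and countably many of them fill [U]. *)
Lemma open_measurable_row (U : set 'rV[R]_n) : open U -> measurable U.
Proof.
move=> oU.
pose D := [set p : nat * nat | ball (rat_point p.1) p.2.+1%:R^-1 `<=` U].
rewrite (_ : U = \bigcup_(p in D) ball (rat_point p.1) p.2.+1%:R^-1); last first.
  apply/seteqP; split => x; last by move=> [p Dp]; exact: Dp.
  move=> Ux; have /nbhs_ballP[e /= e0 eU] := open_nbhs_nbhs (conj oU Ux).
  have [k ke] : exists k, k.+1%:R^-1 < e / 2.
    by have [k _ /(_ k (leqnn k))] := 
      near_infty_natSinv_lt (PosNum (divr_gt0 e0 (ltr0n R 2))); exists k.
  have k0 : 0 < k.+1%:R^-1 :> R by rewrite invr_gt0.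
  have [i xi] := rat_point_dense x k0.
  exists (i, k) => //= t it; apply: eU.
  apply: (@le_ball _ _ _ (e / 2 + e / 2)); first by rewrite -splitr.
  by apply: (ball_triangle (ball_sym (le_ball _ xi)) (le_ball _ it)); exact: ltW.
rewrite bigcup_mkcond; apply: countable_bigcupT_measurable => // p.
case: ifP => // _; apply: measurable_ball_row; rewrite invr_gt0; exact: ltr0Sn.
Qed.

Lemma continuous_measurable_row (h : 'rV[R]_n -> R) : continuous h ->
  measurable_fun setT h.
Proof.
move=> /continuousP ch; apply: (measurability _ (RGenOpens.measurableE R)).
move=> _ [_ [a [b ->]] <-]; rewrite setTI; apply: open_measurable_row.
exact/ch/interval_open.
Qed.

End rational_grid.

(** * Tonelli and affine changes of variable *)

Section lebesgue_row_integral.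
Context (R : realType).
Local Open Scope ereal_scope.

Lemma ge0_integral_rowS n (F : 'rV[R]_n.+1 -> \bar R) :
  measurable_fun setT F -> (forall t, 0 <= F t) ->
  \int[lebesgue_row R n.+1]_t F t =
  \int[lebesgue_measure]_a \int[lebesgue_row R n]_v F (row_cons (a, v)).
Proof.
move=> mF F0.
have := @ge0_integral_pushforward _ _ (measurableTypeR R * 'rV[R]_n)%type _ R _
  (@measurable_row_cons R n) (lebesgue_measure \x lebesgue_row R n) setT F
  measurableT mF (fun t _ => F0 t).
rewrite preimage_setT => E; refine (eq_trans E _).
rewrite fubini_tonelli1//; last by move=> x; exact: F0.
by apply: measurableT_comp => //; exact: measurable_row_cons.
Qed.

(** Uniqueness of Lebesgue measure: its image under the reflection and dilation [h], divided by [y],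
    gives each half-open interval its length. *)
Lemma ge0_integral_affine1 (y c : R) (F : R -> \bar R) : (0 < y)%R ->
  measurable_fun setT F -> (forall t, 0 <= F t) ->
  \int[lebesgue_measure]_a F (y^-1 * (c - a))%R =
  y%:E * \int[lebesgue_measure]_a F a.
Proof.
move=> y0 mF F0; pose h (a : R) : R := (y^-1 * (c - a))%R.
have mh : measurable_fun setT h by apply: measurable_funM => //; apply: measurable_funB.
have yn0 : (0 <= y^-1)%R by rewrite invr_ge0 ltW.
pose nu : {measure set (measurableTypeR R) -> \bar R} :=
  measure_function_pushforward__canonical__measure_function_Measure
    (@lebesgue_measure R) (mh : @measurable_fun _ _ _ (measurableTypeR R) _ _).
pose mu := mscale (NngNum yn0) nu.
have hmu (A : set R) : measurable A -> lebesgue_measure A = mu A.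
  apply: lebesgue_measure_unique => _ [[u v] /= uv <-].
  rewrite /mu /mscale /= /nu /= /pushforward.
  rewrite (_ : h @^-1` _ = `[(c - y * v)%R, (c - y * u)%R[%classic); last first.
    apply/seteqP; split => a /=; rewrite !in_itv/= /h.
      rewrite [(y^-1 * _)%R]mulrC ltr_pdivlMr// ler_pdivrMr// => /andP[? ?].
      by apply/andP; split; lra.
    rewrite [(y^-1 * _)%R]mulrC ltr_pdivlMr// ler_pdivrMr// => /andP[? ?].
    by apply/andP; split; lra.
  rewrite !lebesgue_measure_itv/= !lte_fin.
  have -> : (c - y * v < c - y * u)%R = (u < v)%R by rewrite ltrD2l ltrN2 ltr_pM2l.
  case: ifPn => _; last by rewrite mule0.
  rewrite !EFinN -!EFinB -EFinM; congr EFin; field; exact: lt0r_neq0.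
rewrite (_ : \int[lebesgue_measure]_a F a = \int[mu]_a F a); last first.
  apply: eq_measure_integral => A mA _; exact: hmu.
have := @ge0_integral_pushforward _ _ (measurableTypeR R) (measurableTypeR R) R
  h mh (@lebesgue_measure R) setT F measurableT mF (fun t _ => F0 t).
rewrite preimage_setT => E.
rewrite ge0_integral_mscale//= [X in _ = _ * (_ * X)](_ : _ =
  \int[lebesgue_measure]_a F (h a))//.
rewrite muleA -EFinM divff ?mul1e//; exact: lt0r_neq0.
Qed.

Lemma measurable_fun_affine n (y : R) (x : 'rV[R]_n) :
  measurable_fun setT (fun t : 'rV[R]_n => y^-1 *: (x - t))%R.
Proof.
apply: measurable_fun_row => i.
rewrite (_ : _ \o _ = fun t => y^-1 * (x ord0 i - row_coord i t))%R; last first.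
  by apply/funext => t; rewrite /row_coord /= !mxE.
by apply: measurable_funM => //; apply: measurable_funB => //; exact: measurable_row_coord.
Qed.

(** Induction on the dimension: the induction hypothesis treats all coordinates but the first and
    gives y^n, and the first one gives the last factor. *)
Lemma ge0_integral_affine n (y : R) (x : 'rV[R]_n) (F : 'rV[R]_n -> \bar R) :
  (0 < y)%R -> measurable_fun setT F -> (forall t, 0 <= F t) ->
  \int[lebesgue_row R n]_t F (y^-1 *: (x - t))%R =
  (y ^+ n)%:E * \int[lebesgue_row R n]_t F t.
Proof.
move=> y0; elim: n => [|n IH] in x F *.
  move=> mF F0; rewrite expr0 mul1e; apply: eq_integral => t _.
  by congr F; apply/rowP => -[].
move=> mF F0.
have maff := measurable_fun_affine y x.
rewrite ge0_integral_rowS//; last exact: measurableT_comp mF maff.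
rewrite ge0_integral_rowS//.
pose G (a : R) := \int[lebesgue_row R n]_v F (row_cons (a, v)).
have mG : measurable_fun setT G.
  apply: (@measurable_fun_fubini_tonelli_F _ _ _ _ _ (lebesgue_row R n)
    (F \o @row_cons R n)); last by move=> ?; exact: F0.
  by apply: measurableT_comp => //; exact: measurable_row_cons.
have mFa a : measurable_fun setT (fun v => F (row_cons (a, v))).
  apply: measurableT_comp => //; apply: measurableT_comp => //.
  exact: measurable_row_cons.
have G0 a : 0 <= G a by apply: integral_ge0.
transitivity (\int[lebesgue_measure]_a ((y ^+ n)%:E * G (y^-1 * (x ord0 ord0 - a))%R)).
  apply: eq_integral => a _; rewrite /G.
  rewrite -(IH (@rsubmx _ 1 1 n x))//; apply: eq_integral => v _; congr F.
  apply/rowP => i; rewrite /row_cons /=.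
  case: (split_ordP (i : 'I_(1 + n))) => j ->; rewrite !mxE.
    rewrite (unsplitK (inl j)) !mxE (ord1 j) eqxx !mulr1n.
    by congr (_ * (x _ _ - _))%R; exact: val_inj.
  by rewrite (unsplitK (inr j)) !mxE.
have mGa : measurable_fun setT (fun a : R => G (y^-1 * (x ord0 ord0 - a))%R).
  apply: (measurableT_comp mG).
  by apply: measurable_funM => //; apply: measurable_funB.
rewrite (@ge0_integralZl _ (measurableTypeR R) R (@lebesgue_measure R) setT
  measurableT (fun a => G (y^-1 * (x ord0 ord0 - a))%R) mGa (y ^+ n)%:E).
- by rewrite ge0_integral_affine1// muleA -EFinM exprSr.
- by move=> a _; exact: G0.
- by rewrite lee_fin exprn_ge0// ltW.
Qed.

Lemma integral_affine n (y : R) (x : 'rV[R]_n) (F : 'rV[R]_n -> \bar R) :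
  (0 < y)%R -> measurable_fun setT F ->
  \int[lebesgue_row R n]_t F t \is a fin_num ->
  \int[lebesgue_row R n]_t F (y^-1 *: (x - t))%R =
  (y ^+ n)%:E * \int[lebesgue_row R n]_t F t.
Proof.
move=> y0 mF; rewrite [\int[_]_t F t]integralE => fF.
have Ep := @ge0_integral_affine n y x F^\+ y0 (measurable_funepos mF) (funepos_ge0 F).
have En := @ge0_integral_affine n y x F^\- y0 (measurable_funeneg mF) (funeneg_ge0 F).
rewrite [LHS]integralE -!/(F \o _) funepos_comp funeneg_comp /comp Ep En -muleBr//.
by apply: fin_num_adde_defl; rewrite fin_numN; move: fF; rewrite fin_numB => /andP[].
Qed.

End lebesgue_row_integral.

(** * An integrable weight *)

Section weight.
Context (R : realType).

(** The reference weight for all quadrature errors. Being a product of one-variable factors, it is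
    integrable by induction on n, and it varies by at most a constant factor over unit balls. *)
Definition cauchy_weight n (x : 'rV[R]_n) : R := \prod_i (1 + x ord0 i ^+ 2)^-1.

Lemma cauchy_weight_gt0 n (x : 'rV[R]_n) : 0 < cauchy_weight x.
Proof. by apply: prodr_gt0 => i _; rewrite invr_gt0 ltr_pwDl// sqr_ge0. Qed.

Lemma measurable_cauchy_weight n : measurable_fun setT (@cauchy_weight n).
Proof.
apply: measurable_prod => i _.
apply: (@measurableT_comp _ _ _ _ _ _ (fun u : R => (1 + u ^+ 2)^-1) _
  (@row_coord R n i)); last exact: measurable_row_coord.
exact: continuous_measurable_fun (@continuous_oneDsqrV R).
Qed.

Lemma integral_cauchy_weight n :
  (\int[lebesgue_row R n]_t (cauchy_weight t)%:E < +oo)%E.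
Proof.
have mW m : measurable_fun setT (fun t => (@cauchy_weight m t)%:E).
  by apply/measurable_EFinP; exact: measurable_cauchy_weight.
have W0 m (t : 'rV[R]_m) : (0 <= (cauchy_weight t)%:E)%E.
  by rewrite lee_fin ltW// cauchy_weight_gt0.
elim: n => [|n IH].
  have := integral_dirac (0 : 'rV[R]_0) measurableT (mW 0%N).
  by rewrite diracT mul1e /= => ->; rewrite ltry.
rewrite ge0_integral_rowS//.
pose I := fine (\int[lebesgue_row R n]_t (cauchy_weight t)%:E).
have IE : (\int[lebesgue_row R n]_t (cauchy_weight t)%:E = I%:E)%E.
  by rewrite fineK// ge0_fin_numE// integral_ge0.
have I0 : 0 <= I by rewrite fine_ge0// integral_ge0.
under eq_integral => a _.
  under eq_integral => v _.
    rewrite (_ : cauchy_weight _ = (oneDsqr a)^-1 * cauchy_weight v); last first.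
      rewrite /cauchy_weight big_ord_recl; congr (_ * _).
        rewrite /row_cons/= (_ : ord0 = lshift n (ord0 : 'I_1)); last exact: val_inj.
        by rewrite (@row_mxEl R 1 1 n) mxE eqxx mulr1n.
      apply: eq_bigr => i _; rewrite (_ : lift _ _ = rshift 1 i); last exact: val_inj.
      by rewrite /row_cons (@row_mxEr R 1 1 n).
    rewrite EFinM; over.
  rewrite (@ge0_integralZl _ _ R (lebesgue_row R n) setT measurableT
    (fun v => (cauchy_weight v)%:E) (mW n) ((oneDsqr a)^-1)%:E (fun v _ => W0 n v));
    last by rewrite lee_fin invr_ge0 ltW// oneDsqr_gt0.
  rewrite IE muleC; over.
have mD : measurable_fun setT (fun x : R => ((oneDsqr x)^-1)%:E).
  apply/measurable_EFinP.
  exact: continuous_measurable_fun (@continuous_oneDsqrV R).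
rewrite (@ge0_integralZl _ (measurableTypeR R) R (@lebesgue_measure R) setT
  measurableT (fun a => ((oneDsqr a)^-1)%:E) mD I%:E)//.
- rewrite (@ge0_symfun_integralT R (fun x => (oneDsqr x)^-1)).
  + rewrite (_ : [set x | 0 <= x] = `[0, +oo[%classic).
      by rewrite integral0y_oneDsqr -!EFinM ltry.
    by apply/seteqP; split => x /=; rewrite in_itv/= andbT.
  + by move=> x; rewrite invr_ge0 ltW// oneDsqr_gt0.
  + exact: continuous_oneDsqrV.
  + by move=> x; rewrite /= /oneDsqr sqrrN.
Qed.

(** In each coordinate |a - b| < 1 gives a^2 <= 2 b^2 + 2, hence 1 + a^2 <= 3 (1 + b^2). *)
Lemma cauchy_weight_ball n (x t : 'rV[R]_n) : ball x 1 t ->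
  cauchy_weight t <= 3 ^+ n * cauchy_weight x.
Proof.
move=> /ball_row H; rewrite /cauchy_weight -[X in _ ^+ X]card_ord -prodr_const -big_split/=.
apply: ler_prod => i _; rewrite invr_ge0 addr_ge0 ?sqr_ge0//=.
rewrite ler_pdivlMr ?ltr_pwDl ?sqr_ge0// mulrC ler_pdivrMr ?ltr_pwDl ?sqr_ge0//.
have := H ltr01 i; move: (x ord0 i) (t ord0 i) => a b; rewrite ltr_norml => /andP[? ?].
have : 0 <= (1 - (a - b)) * (1 + (a - b)) by apply: mulr_ge0; lra.
have := sqr_ge0 (a - 2 * b); nra.
Qed.

End weight.

(** * Quadrature with uniform error *)

Section quadrature.
Context (R : realType) (n : nat).
Notation mu := (lebesgue_row R n).
Notation W := (@cauchy_weight R n).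

Lemma integrable_cauchy_weight : mu.-integrable setT (EFin \o W).
Proof.
apply/integrableP; split.
  by apply/measurable_EFinP; exact: measurable_cauchy_weight.
under eq_integral => t _ do
  rewrite /= (ger0_norm (ltW (cauchy_weight_gt0 t))).
exact: integral_cauchy_weight.
Qed.

Lemma integrable_cauchy_dominated (h : 'rV[R]_n -> R) (K : R) :
  measurable_fun setT h -> (forall x, `|h x| <= K * W x) ->
  mu.-integrable setT (EFin \o h).
Proof.
move=> mh hK; apply: (le_integrable measurableT (g := EFin \o (fun x => K * W x))).
- exact/measurable_EFinP.
- move=> x _; rewrite /= lee_fin (le_trans (hK x))//; exact: ler_norm.
- rewrite (_ : EFin \o _ = (fun x => K%:E * (EFin \o W) x)%E)//.
  exact: integrableZl integrable_cauchy_weight.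
Qed.

Lemma Rintegral_seqDU (A : (set 'rV[R]_n)^nat) (h : 'rV[R]_n -> R) N :
  (forall i, measurable (A i)) -> trivIset setT A ->
  mu.-integrable setT (EFin \o h) ->
  \int[mu]_t h t = \sum_(i < N) \int[mu]_(t in A i) h t +
    \int[mu]_(t in ~` \big[setU/set0]_(i < N) A i) h t.
Proof.
move=> mA tA ih; elim: N => [|N IH].
  by rewrite !big_ord0 add0r setC0.
rewrite IH !big_ord_recr/= -addrA; congr (_ + _).
set U := \big[setU/set0]_(i < N) A i.
have mU : measurable U by exact: bigsetU_measurable.
have UA : U `&` A N = set0.
  rewrite setIC /U -bigcup_mkord setI_bigcupr bigcup0// => i /= iN.
  by have /trivIsetP := tA; apply => //; rewrite neq_ltn iN orbT.
rewrite (_ : ~` U = A N `|` ~` (U `|` A N)); last first.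
  rewrite setCU; apply/seteqP; split => x.
    by have [AN|nAN] := pselect (A N x); [left|right].
  by move=> [ANx Ux|[]//]; have : (U `&` A N) x by []; rewrite UA.
rewrite Rintegral_setU//.
- by apply: measurableC; exact: measurableU.
- by apply: integrableS ih => //; apply: measurableU => //; apply: measurableC; exact: measurableU.
- by apply/disj_setPS => x [ANx]; rewrite /setC/=; apply; right.
Qed.

(** By countable additivity the integrals of [W] over the first cells converge to its full
    integral. *)
Lemma Rintegral_seqDU_tail (A : (set 'rV[R]_n)^nat) (eta : R) : 0 < eta ->
  (forall i, measurable (A i)) -> trivIset setT A -> \bigcup_i A i = setT ->
  exists N, \int[mu]_(t in ~` \big[setU/set0]_(i < N) A i) W t <= eta.
Proof.
move=> eta0 mA tA AT.
have iW := integrable_cauchy_weight.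
have mW : measurable_fun setT (EFin \o W) by case/integrableP : iW.
have W0 x : (0 <= (EFin \o W) x)%E by rewrite /= lee_fin ltW// cauchy_weight_gt0.
have := @ge0_integral_bigcup _ _ R mu A (EFin \o W) mA.
rewrite AT => /(_ mW (fun x _ => W0 x) tA) E.
have c : (\sum_(0 <= i < k) \int[mu]_(x in A i) (W x)%:E)%E @[k --> \oo] -->
    (\int[mu]_x (W x)%:E)%E.
  by rewrite E; apply/is_cvg_nneseries => i _ _; apply: integral_ge0 => x _; exact: W0.
have iWA i : mu.-integrable (A i) (EFin \o W) by exact: integrableS iW.
have fW : (\int[mu]_x (W x)%:E)%E \is a fin_num by exact: integrable_fin_num.
have : \sum_(0 <= i < k) \int[mu]_(x in A i) W x @[k --> \oo] --> \int[mu]_x W x.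
  move: c; rewrite -(fineK fW) => /fine_cvg; apply: cvg_trans; apply: near_eq_cvg.
  near=> k => /=; rewrite /Rintegral sum_fine// => i _; exact: integrable_fin_num.
move=> /cvgr_dist_le /(_ _ eta0)[N _ /(_ N (leqnn N))] /= H.
exists N; apply: le_trans H; apply: le_trans (ler_norm _).
by rewrite (Rintegral_seqDU N mA tA iW) big_mkord addrC addKr.
Unshelve. all: by end_near. Qed.

(* The point is that one finite family of weights and nodes serves all the
   functions [h] with a given constant [K]. *)
Lemma quadrature : exists2 C : R, 0 <= C & forall eta : R, 0 < eta ->
  exists (N : nat) (w : nat -> R) (z : nat -> 'rV[R]_n),
  [/\ forall i, 0 <= w i, \sum_(i < N) w i * W (z i) <= C &
    forall (h : 'rV[R]_n -> R) (K : R), measurable_fun setT h -> 0 <= K ->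
      (forall x, `|h x| <= K * W x) ->
      (forall x (e : R) x', 0 < e <= 1 -> ball x e x' -> `|h x - h x'| <= K * e * W x) ->
      `|\sum_(i < N) w i * h (z i) - \int[mu]_t h t| <= eta * K].
Proof.
have W0 x := ltW (@cauchy_weight_gt0 R n x).
set I := \int[mu]_t W t.
have I0 : 0 <= I by exact: Rintegral_ge0.
(* [cauchy_weight_ball] compares the weight at a node with its values on the cell, which costs
   3^n. *)
exists (3 ^+ n * I) => [|eta eta0]; first by rewrite mulr_ge0.
(* Mesh size: the oscillation on the cells then costs at most half of [eta], and the other half is
   left for the complement of the first [N] cells. *)
pose e := Num.min 1 (eta / 2 / (I + 1)).
have I1 : 0 < I + 1 by rewrite ltr_pwDr.
have e0 : 0 < e by rewrite lt_min ltr01 !divr_gt0.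
have e1 : e <= 1 by rewrite ge_min lexx.
have eI : e * I <= eta / 2.
  apply: le_trans (_ : eta / 2 / (I + 1) * (I + 1) <= _); last by rewrite divfK// gt_eqF.
  by apply: ler_pM => //; [exact: ltW|rewrite ge_min lexx orbT|rewrite lerDl].
pose B i := ball (@rat_point R n i) e.
(* The cells are the rational balls made disjoint. The node of a cell is the centre of its ball and
   need not lie in the cell. *)
pose A := seqDU B.
have mA i : measurable (A i).
  by apply: seqDU_measurable => k; exact: measurable_ball_row.
have tA : trivIset setT A by exact: trivIset_seqDU.
have AT : \bigcup_i A i = setT.
  rewrite -seqDU_bigcup_eq; apply/seteqP; split => // x _.
  by have [i ix] := rat_point_dense x e0; exists i.
have AB i : A i `<=` B i by exact: subset_seqDU.
have AB1 i x : A i x -> ball (@rat_point R n i) 1 x.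
  by move=> /AB; exact: le_ball.
have [N HN] := Rintegral_seqDU_tail (divr_gt0 eta0 (ltr0n R 2)) mA tA AT.
have iW := integrable_cauchy_weight.
have iWA i : mu.-integrable (A i) (EFin \o W) by exact: integrableS iW.
pose w i := fine (mu (A i)).
have w0 i : 0 <= w i by exact/fine_ge0/measure_ge0.
(* A cell has finite measure because the weight is bounded below on it. *)
have iA i : mu.-integrable (A i) (EFin \o cst 1).
  apply: (le_integrable (mA i)
    (g := EFin \o (fun x => 3 ^+ n / W (@rat_point R n i) * W x))).
  - by apply/measurable_EFinP.
  - move=> x Ax; rewrite /= lee_fin normr1 ger0_norm ?mulr_ge0 ?invr_ge0 ?exprn_ge0//.
    rewrite mulrAC ler_pdivlMr ?cauchy_weight_gt0// mul1r.
    by apply: cauchy_weight_ball; apply: ball_sym; exact: AB1.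
  - rewrite (_ : EFin \o _ = (fun x => (3 ^+ n / W (@rat_point R n i))%:E * (EFin \o W) x)%E)//.
    exact: integrableZl.
have wE i (c : R) : w i * c = \int[mu]_(t in A i) c by rewrite Rintegral_cst// mulrC.
have icst i (c : R) : mu.-integrable (A i) (EFin \o cst c).
  rewrite (_ : EFin \o _ = (fun x => c%:E * (EFin \o cst (1 : R)%R) x)%E).
    exact: integrableZl.
  by apply/funext => x /=; rewrite mule1.
have iZ i (c : R) : mu.-integrable (A i) (EFin \o (fun x => c * W x)).
  rewrite (_ : EFin \o _ = (fun x => c%:E * (EFin \o W) x)%E)//; exact: integrableZl.
have sumW : \sum_(i < N) \int[mu]_(t in A i) W t <= I.
  by rewrite /I (Rintegral_seqDU N mA tA iW) lerDl Rintegral_ge0.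
exists N, w, (@rat_point R n); split => //.
  apply: le_trans (_ : \sum_(i < N) 3 ^+ n * \int[mu]_(t in A i) W t <= _); last first.
    by rewrite -mulr_sumr ler_wpM2l// exprn_ge0.
  apply: ler_sum => i _; rewrite wE -RintegralZl//.
  apply: le_Rintegral; [by []|exact: icst|exact: iZ|move=> x Ax].
  by apply: cauchy_weight_ball; apply: ball_sym; exact: AB1.
move=> h K mh K0 hK hL.
have ih := integrable_cauchy_dominated mh hK.
have ihA i : mu.-integrable (A i) (EFin \o h) by exact: integrableS ih.
rewrite (Rintegral_seqDU N mA tA ih) opprD addrA -sumrB.
rewrite (splitr eta) mulrDl; apply: le_trans (ler_normB _ _) _; apply: lerD.
  apply: le_trans (ler_norm_sum _ _ _) _.
  apply: le_trans (_ : \sum_(i < N) K * e * \int[mu]_(t in A i) W t <= _); last first.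
    rewrite -mulr_sumr -mulrA mulrC ler_wpM2r//; apply: le_trans eI.
    by rewrite ler_wpM2l// ltW.
  apply: ler_sum => i _; rewrite wE -RintegralB//; last exact: icst.
  rewrite -RintegralZl//.
  have ib : mu.-integrable (A i) (EFin \o (fun x => h (@rat_point R n i) - h x)).
    rewrite (_ : EFin \o _ = (EFin \o cst (h (@rat_point R n i))) \- (EFin \o h))%E//.
    by apply: integrableB => //; exact: icst.
  apply: le_trans (le_normr_Rintegral (mA i) ib) _.
  apply: le_Rintegral; [by []|exact: (integrable_norm ib)|exact: iZ|move=> x Ax].
   rewrite distrC; apply: hL; first by rewrite e0.
  by apply: ball_sym; exact: AB.
set T := ~` _ in HN *.
have mT : measurable T by apply: measurableC; exact: bigsetU_measurable.
have ihT : mu.-integrable T (EFin \o h) by exact: integrableS ih.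
have iWT : mu.-integrable T (EFin \o W) by exact: integrableS iW.
apply: le_trans (le_normr_Rintegral mT ihT) _.
apply: le_trans (_ : \int[mu]_(t in T) (K * W t) <= _).
  apply: le_Rintegral => //; first by have := integrable_norm ihT.
  rewrite (_ : EFin \o _ = (fun x => K%:E * (EFin \o W) x)%E)//; exact: integrableZl.
by rewrite RintegralZl// mulrC ler_wpM2r.
Qed.

End quadrature.

(** * Points of full-measure sets are dense in the strip *)

Section density.
Context (R : realType).

Lemma lebesgue_row_ball_gt0 n (x : 'rV[R]_n) (e : R) : 0 < e ->
  (0 < lebesgue_row R n (ball x e))%E.
Proof.
move=> e0; elim: n => [|n IH] in x *.
  by rewrite /= diracE mem_set//; apply/ball_row => // -[].
apply: lt_le_trans (_ : (lebesgue_measure \x lebesgue_row R n)%E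
    (ball (x ord0 ord0) e `*` ball (@rsubmx _ 1 1 n x) e) <= _)%E.
  rewrite product_measure1E//; [|exact: measurable_ball|exact: measurable_ball_row].
  apply: mule_gt0; last exact: IH.
  have := lebesgue_measure_ball (x ord0 ord0) (ltW e0) => /= ->.
  by rewrite lte_fin mulrn_wgt0.
rewrite [leRHS](_ : _ = (lebesgue_measure \x lebesgue_row R n)%E
  (@row_cons R n @^-1` ball x e))//.
apply: le_measure; rewrite ?inE.
- by apply: measurableX; [exact: measurable_ball|exact: measurable_ball_row].
- rewrite -[X in measurable X]setTI; apply: measurable_row_cons => //.
  exact: measurable_ball_row.
move=> [a v] [/= xa /ball_row xv]; apply/ball_row => // i; rewrite /row_cons/=.
case: (split_ordP (i : 'I_(1 + n))) => j ->.
  rewrite (@row_mxEl R 1 1 n) (ord1 j) mxE eqxx mulr1n.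
  by rewrite (_ : lshift n (0 : 'I_1) = ord0 :> 'I_n.+1)//; exact: val_inj.
by rewrite (@row_mxEr R 1 1 n); have := xv e0 j; rewrite mxE.
Qed.

(** A box has positive measure, so it is not contained in a null set. The box extends only below
    [y], which keeps it in the strip when [y] is 1. *)
Lemma ae_strip_dense n (P : 'rV[R]_n * R -> Prop) (x : 'rV[R]_n) (y e : R) :
  ae_strip P -> 0 < y <= 1 -> 0 < e ->
  exists x' y', [/\ ball x e x', y - e < y' <= y, 0 < y' & P (x', y')].
Proof.
move=> [N [mN N0 PN]] /andP[y0 y1] e0; apply: contrapT => nE.
pose m := Num.max 0 (y - e).
have my : m < y by rewrite gt_max y0; lra.
pose B := ball x e `*` `]m, y]%classic.
have BN : B `<=` N.
  move=> [x' y'] [/= xx']; rewrite in_itv/= gt_max => /andP[/andP[y'0 ye] y'y].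
  apply: PN => /= H; apply: nE; exists x', y'; split => //; first by rewrite ye.
  by apply: H; rewrite /strip/= y'0 (le_trans y'y).
have mB : measurable B by apply: measurableX => //; exact: measurable_ball_row.
have : ((lebesgue_row R n \x lebesgue_measure) B <= 0)%E.
  by rewrite -N0; apply: le_measure; rewrite ?inE.
rewrite leNgt => /negP; apply.
rewrite product_measure1E//; last exact: measurable_ball_row.
rewrite mule_gt0 ?lebesgue_row_ball_gt0//.
have := @lebesgue_measure_itv R `]m, y] => /= ->.
by rewrite lte_fin my lte_fin subr_gt0.
Qed.

End density.

(** * Schwartz functions *)

Section complex_norm.
Context (R : realType).
Implicit Types z w : R[i].

Lemma normc_ge0 z : 0 <= Normc.normc z.
Proof. by case: z => a b; exact: sqrtr_ge0. Qed.

Lemma Re_le_normc z : `|complex.Re z| <= Normc.normc z.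
Proof.
by case: z => a b /=; rewrite -sqrtr_sqr ler_wsqrtr// lerDl sqr_ge0.
Qed.

Lemma Im_le_normc z : `|complex.Im z| <= Normc.normc z.
Proof.
by case: z => a b /=; rewrite -sqrtr_sqr ler_wsqrtr// lerDr sqr_ge0.
Qed.

Lemma Re_dist_normc z w : `|complex.Re z - complex.Re w| <= Normc.normc (z - w).
Proof. by apply: le_trans (Re_le_normc (z - w)); case: z w => [a b] [c d]. Qed.

Lemma Im_dist_normc z w : `|complex.Im z - complex.Im w| <= Normc.normc (z - w).
Proof. by apply: le_trans (Im_le_normc (z - w)); case: z w => [a b] [c d]. Qed.

Lemma normc_le_ReIm z : Normc.normc z <= `|complex.Re z| + `|complex.Im z|.
Proof.
case: z => a b /=; rewrite -[leRHS]ger0_norm ?addr_ge0// -sqrtr_sqr ler_wsqrtr//.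
by rewrite sqrrD !real_normK ?num_real// lerD2r lerDl mulrn_wge0 ?mulr_ge0.
Qed.

Lemma normcN z : Normc.normc (- z) = Normc.normc z.
Proof. by case: z => a b /=; rewrite !sqrrN. Qed.

Lemma normc_real (a : R) : Normc.normc a%:C%C = `|a|.
Proof. by rewrite /= expr0n /= addr0 sqrtr_sqr. Qed.

Lemma norm_complexE z : `|z| = (Normc.normc z)%:C%C.
Proof. by []. Qed.

End complex_norm.

(** * Euclidean norm and the polynomial weight *)

Section euclidean_norm.
Context (R : realType) (n : nat).
Implicit Types x t v : 'rV[R]_n.

Lemma enormD x t : enorm (x + t) <= enorm x + enorm t.
Proof.
have sum0 (u : 'rV[R]_n) : 0 <= \sum_i u ord0 i ^+ 2 by apply: sumr_ge0 => i _; exact: sqr_ge0.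
have sqE (u : 'rV[R]_n) : enorm u ^+ 2 = \sum_i u ord0 i ^+ 2 by rewrite sqr_sqrtr.
set p := \sum_i x ord0 i * t ord0 i.
have cs : p <= enorm x * enorm t.
  set A := \sum_i x ord0 i ^+ 2; set B := \sum_i t ord0 i ^+ 2.
  (* Cauchy-Schwarz, read off from the nonnegative sum of the squares of B x_i - p t_i. *)
  have BAp : 0 <= B * (A * B - p ^+ 2).
    rewrite (_ : B * _ = \sum_i (B * x ord0 i - p * t ord0 i) ^+ 2).
      by apply: sumr_ge0 => i _; exact: sqr_ge0.
    rewrite (_ : B * _ = B ^+ 2 * A - (B * p) * p *+ 2 + p ^+ 2 * B); last by ring.
    rewrite (eq_bigr (fun i => B ^+ 2 * (x ord0 i ^+ 2) -
      (B * p) *+ 2 * (x ord0 i * t ord0 i) + p ^+ 2 * (t ord0 i ^+ 2))); last first.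
      by move=> i _; ring.
    by rewrite big_split sumrB/= -!mulr_sumr -/A -/p -/B; ring.
  have [B0|B0] := eqVneq B 0.
    have t0 i : t ord0 i = 0.
      by apply/eqP; rewrite -sqrf_eq0; have /eqP := B0;
        rewrite psumr_eq0 => [/allP/(_ i (mem_index_enum i))//|k _]; exact: sqr_ge0.
    by rewrite /p big1 ?mulr_ge0 ?enorm_ge0// => i _; rewrite t0 mulr0.
  move: BAp; rewrite pmulr_rge0 ?lt0r ?B0 ?sum0// subr_ge0 => pAB.
  rewrite (le_trans (ler_norm p))// -sqrtr_sqr /enorm -sqrtrM ?sum0//.
  exact: ler_wsqrtr.
rewrite -ler_sqr ?nnegrE ?addr_ge0 ?enorm_ge0//.
rewrite sqrrD !sqE (_ : \sum_i (x + t) ord0 i ^+ 2 =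
  \sum_i x ord0 i ^+ 2 + p *+ 2 + \sum_i t ord0 i ^+ 2).
  by rewrite lerD2r lerD2l lerMn2r cs orbT.
rewrite /p -sumrMnl -!big_split/=; apply: eq_bigr => i _.
by rewrite !mxE sqrrD.
Qed.

Lemma enormZ (a : R) x : enorm (a *: x) = `|a| * enorm x.
Proof.
rewrite /enorm -sqrtr_sqr -sqrtrM ?sqr_ge0// mulr_sumr; congr Num.sqrt.
by apply: eq_bigr => i _; rewrite mxE exprMn.
Qed.

Lemma enormN x : enorm (- x) = enorm x.
Proof. by rewrite -scaleN1r enormZ normrN1 mul1r. Qed.

Lemma enorm_le_ball x t (e : R) : ball x e t -> enorm (t - x) <= n%:R * e.
Proof.
move=> [e0 H]; rewrite (le_trans (enorm_le_sum _))//.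
rewrite mulr_natl -[X in _ *+ X]card_ord -sumr_const; apply: ler_sum => i _.
by rewrite !mxE distrC ltW//; exact: H.
Qed.

Definition wt x : R := 1 + enorm x.

Lemma wt_ge1 x : 1 <= wt x. Proof. by rewrite lerDl enorm_ge0. Qed.

Lemma wt_gt0 x : 0 < wt x. Proof. exact: lt_le_trans (wt_ge1 x). Qed.

Lemma wt_ge0 x : 0 <= wt x. Proof. exact/ltW/wt_gt0. Qed.

Lemma wtX_gt0 x k : 0 < wt x ^+ k. Proof. exact/exprn_gt0/wt_gt0. Qed.

Lemma wtX_ge0 x k : 0 <= wt x ^+ k. Proof. exact/ltW/wtX_gt0. Qed.

(** The product (1 + a)(1 + b) exceeds 1 + a + b by ab. This submultiplicativity is what makes a
    translation cost only a power of the weight. *)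
Lemma wtD x t : wt (x + t) <= wt x * wt t.
Proof.
have := enormD x t; rewrite /wt; have := enorm_ge0 x; have := enorm_ge0 t; nra.
Qed.

Lemma wtXD x t k : wt (x + t) ^+ k <= wt x ^+ k * wt t ^+ k.
Proof. by rewrite -exprMn lerXn2r ?nnegrE ?wtD ?mulr_ge0 ?wt_ge0. Qed.

Lemma wtZ_le (a : R) x : `|a| <= 1 -> wt (a *: x) <= wt x.
Proof. by move=> a1; rewrite lerD2l enormZ ler_piMl ?enorm_ge0. Qed.

Lemma wtN x : wt (- x) = wt x. Proof. by rewrite /wt enormN. Qed.

End euclidean_norm.

(** * Mean value theorem along a segment *)

Section mean_value.
Context (R : realType) (n : nat).
Implicit Types (h : 'rV[R]_n -> R) (t v : 'rV[R]_n).

Lemma mean_value h t v : (forall x, differentiable h x) ->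
  exists2 c : R, 0 <= c <= 1 &
    h (t + v) - h t = \sum_i v ord0 i * 'D_(delta_mx ord0 i) h (t + c *: v).
Proof.
move=> dh; pose l : R -> 'rV[R]_n := cst t + *:%R^~ v.
have dl (c : R) : is_diff c l (0 + *:%R^~ v).
  exact: is_diffD.
pose g := h \o l.
have dg (c : R) : is_derive c 1 g ('d h (l c) v).
  have dgc : is_diff c g ('d h (l c) \o (0 + *:%R^~ v)).
    apply: is_diff_comp; exact: DiffDef.
  apply: DeriveDef; first exact/diff_derivable.
  rewrite deriveE// diff_val /=; congr ('d h _ _).
  by rewrite !fctE add0r scale1r.
have [|c c01 E] := @MVT_segment R g (fun c => 'd h (l c) v) 0 1 ler01
  (fun c _ => dg c).
  by apply: derivable_within_continuous => c _; exact: ex_derive.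
exists c; first by move: c01; rewrite in_itv.
move: E; rewrite subr0 mulr1 /g /l /= !fctE scale1r scale0r addr0 => ->.
move: (t + c *: v) => p; rewrite {1}(row_sum_delta v) linear_sum; apply: eq_bigr => i _.
by rewrite linearZ /= deriveE.
Qed.

End mean_value.

(** * Seminorms under dilation and translation *)

Section schwartz_calculus.
Context (R : realType) (n : nat).
Implicit Types (phi psi : schwartz R n) (x t v : 'rV[R]_n) (k : nat) (s : seq 'I_n).
Notation sn := schwartz_seminorm.

Lemma schwartz_smooth phi : smooth phi.
Proof. by have [] := schwartzP phi. Qed.

Lemma pderivs_schwartzD s phi psi x :
  pderivs s (phi + psi) x = pderivs s phi x + pderivs s psi x.
Proof.
have := @pderivsZD _ _ s 1 _ _ (schwartz_smooth phi) (schwartz_smooth psi).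
by rewrite !scale1r => ->.
Qed.

Lemma pderivs_schwartzZ s (a : R[i]) phi x :
  pderivs s (a *: phi) x = a * pderivs s phi x.
Proof. by have := pderivsZ s a (schwartz_smooth phi) => ->. Qed.

Lemma pderivs_schwartzN s phi x : pderivs s (- phi) x = - pderivs s phi x.
Proof. by rewrite -scaleN1r pderivs_schwartzZ mulN1r. Qed.

Lemma pderivs_schwartzB s phi psi x :
  pderivs s (phi - psi) x = pderivs s phi x - pderivs s psi x.
Proof. by rewrite pderivs_schwartzD pderivs_schwartzN. Qed.

Lemma pderivs_schwartz0 s x : pderivs s (0 : schwartz R n) x = 0.
Proof. by have := @pderivs0 R n s => ->. Qed.

Lemma pderivs_schwartz_sum s I (r : seq I) (F : I -> schwartz R n) x :
  pderivs s (\sum_(i <- r) F i) x = \sum_(i <- r) pderivs s (F i) x.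
Proof.
elim: r => [|i r IH]; first by rewrite !big_nil pderivs_schwartz0.
by rewrite !big_cons pderivs_schwartzD IH.
Qed.

Lemma seminorm_ge0 k s phi : 0 <= sn k s phi.
Proof. by apply: le_trans (weighted_le_seminorm k s phi 0); exact: weighted_ge0. Qed.

Lemma le_seminorm k s phi x : wt x ^+ k * Normc.normc (pderivs s phi x) <= sn k s phi.
Proof. exact: weighted_le_seminorm. Qed.

Lemma normc_le_seminorm s phi x : Normc.normc (pderivs s phi x) <= sn 0 s phi.
Proof. by have := le_seminorm 0 s phi x; rewrite expr0 mul1r. Qed.

Lemma seminormZ_le k s (a : R[i]) phi : sn k s (a *: phi) <= Normc.normc a * sn k s phi.
Proof.
apply: seminorm_le => x; rewrite /weighted pderivs_schwartzZ Normc.normcM mulrCA.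
by rewrite ler_wpM2l ?normc_ge0// le_seminorm.
Qed.

Lemma seminormN_le k s phi : sn k s (- phi) <= sn k s phi.
Proof.
apply: seminorm_le => x; rewrite /weighted pderivs_schwartzN normcN.
exact: le_seminorm.
Qed.

Lemma seminormN k s phi : sn k s (- phi) = sn k s phi.
Proof. by apply/eqP; rewrite eq_le seminormN_le -{1}[phi]opprK seminormN_le. Qed.

Lemma seminormB k s phi psi : sn k s (phi - psi) <= sn k s phi + sn k s psi.
Proof. by rewrite -(seminormN k s psi) seminormD. Qed.

Lemma seminorm_sum k s I (r : seq I) (F : I -> schwartz R n) :
  sn k s (\sum_(i <- r) F i) <= \sum_(i <- r) sn k s (F i).
Proof.
elim: r => [|i r IH]; first by rewrite !big_nil seminorm0.
by rewrite !big_cons (le_trans (seminormD _ _ _ _))// lerD2l.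
Qed.

Lemma pderivs_sdilate s x (y : R) phi t : 0 < y ->
  pderivs s (sdilate x y phi) t =
  (y^-1 ^+ size s)%:C%C * pderivs s phi (y^-1 *: (t - x)).
Proof.
move=> y0; have -> : sdilate x y phi = phi \o affine x y :> ('rV[R]_n -> R[i]).
  by apply/funext => u; rewrite sdilateE.
by rewrite pderivs_affine//; exact: schwartz_smooth.
Qed.

(** Each derivative produces a factor 1/y. With t = x + y u and y <= 1, the weight at t is at most
    the product of the weights at x and u. *)
Lemma seminorm_sdilate k s x (y : R) phi : 0 < y <= 1 ->
  sn k s (sdilate x y phi) <= wt x ^+ k * y^-1 ^+ size s * sn k s phi.
Proof.
move=> /andP[y0 y1]; apply: seminorm_le => t; rewrite /weighted pderivs_sdilate//.
set u := y^-1 *: (t - x).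
rewrite Normc.normcM normc_real ger0_norm ?exprn_ge0 ?invr_ge0 ?(ltW y0)//.
have tE : t = x + y *: u by rewrite /u scalerA divff ?gt_eqF// scale1r addrC subrK.
rewrite -/(wt t) mulrCA [X in _ <= X * _]mulrC -!mulrA.
rewrite ler_wpM2l ?exprn_ge0 ?invr_ge0 ?(ltW y0)//.
apply: le_trans (_ : wt x ^+ k * (wt u ^+ k * Normc.normc (pderivs s phi u)) <= _).
  rewrite mulrA ler_wpM2r ?normc_ge0// tE (le_trans (wtXD _ _ _))//.
  rewrite ler_wpM2l ?wtX_ge0// lerXn2r ?nnegrE ?wt_ge0//.
  by rewrite wtZ_le// gtr0_norm.
by rewrite ler_wpM2l ?wtX_ge0// le_seminorm.
Qed.

Lemma pderivs_translate s x phi t :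
  pderivs s (sdilate x 1 phi) t = pderivs s phi (t - x).
Proof. by rewrite pderivs_sdilate// invr1 expr1n scale1r mul1r. Qed.

Lemma seminorm_translate k s x phi :
  sn k s (sdilate x 1 phi) <= wt x ^+ k * sn k s phi.
Proof.
have := @seminorm_sdilate k s x 1 phi.
by rewrite invr1 expr1n mulr1 ltr01 lexx => /(_ isT).
Qed.

Definition grad_seminorm k s phi : R := \sum_(i < n) sn k (i :: s) phi.

Lemma grad_seminorm_ge0 k s phi : 0 <= grad_seminorm k s phi.
Proof. by apply: sumr_ge0 => i _; exact: seminorm_ge0. Qed.

(** The mean value theorem is applied to real and imaginary parts, hence the factor 2; [wtD] moves
    the weight from the intermediate point back to [t] at the price wt v^k. *)
Lemma schwartz_lipschitz k s phi t v :
  wt t ^+ k * Normc.normc (pderivs s phi (t + v) - pderivs s phi t) <=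
  2 * enorm v * wt v ^+ k * grad_seminorm k s phi.
Proof.
have H (h : 'rV[R]_n -> R) : (forall x, differentiable h x) ->
    (forall i x, `|'D_(delta_mx ord0 i) h x| <= Normc.normc (pderivs (i :: s) phi x)) ->
    wt t ^+ k * `|h (t + v) - h t| <= enorm v * wt v ^+ k * grad_seminorm k s phi.
  move=> dh hD; have [c /andP[c0 c1] ->] := mean_value t v dh.
  apply: le_trans (_ : wt t ^+ k *
    (\sum_i enorm v * Normc.normc (pderivs (i :: s) phi (t + c *: v))) <= _).
    rewrite ler_wpM2l ?wtX_ge0// (le_trans (ler_norm_sum _ _ _))//.
    by apply: ler_sum => i _; rewrite normrM ler_pM// ler_coord_enorm.
  rewrite mulr_sumr /grad_seminorm mulr_sumr; apply: ler_sum => i _.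
  rewrite mulrCA -mulrA ler_wpM2l ?enorm_ge0//.
  set u := t + c *: v.
  apply: le_trans (_ : wt v ^+ k * (wt u ^+ k * Normc.normc (pderivs (i :: s) phi u)) <= _).
    rewrite mulrA ler_wpM2r ?normc_ge0//.
    rewrite (_ : t = - (c *: v) + u); last by rewrite /u addrCA addNr addr0.
    rewrite (le_trans (wtXD _ _ _))// ler_wpM2r ?wtX_ge0//.
    by rewrite lerXn2r ?nnegrE ?wt_ge0// wtN wtZ_le// ger0_norm.
  by rewrite ler_wpM2l ?wtX_ge0// le_seminorm.
have sp := schwartz_smooth phi s.
have Hr := H (@complex.Re R \o pderivs s phi) (fun x => (sp x).1)
  (fun i x => @Re_le_normc R (pderivs (i :: s) phi x)).
have Hi := H (@complex.Im R \o pderivs s phi) (fun x => (sp x).2)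
  (fun i x => @Im_le_normc R (pderivs (i :: s) phi x)).
apply: le_trans (_ : wt t ^+ k *
  (`|complex.Re (pderivs s phi (t + v)) - complex.Re (pderivs s phi t)| +
   `|complex.Im (pderivs s phi (t + v)) - complex.Im (pderivs s phi t)|) <= _).
  rewrite ler_wpM2l ?wtX_ge0//.
  apply: le_trans (normc_le_ReIm _) _.
  by case: (pderivs s phi (t + v)) => a b; case: (pderivs s phi t).
by rewrite mulrDr; move: Hr Hi => /=; lra.
Qed.

Lemma seminorm_translateB k s x phi :
  sn k s (sdilate x 1 phi - phi) <= 2 * enorm x * wt x ^+ k * grad_seminorm k s phi.
Proof.
apply: seminorm_le => t; rewrite /weighted pderivs_schwartzB pderivs_translate.
by have := schwartz_lipschitz k s phi t (- x); rewrite wtN enormN.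
Qed.

End schwartz_calculus.

(** * Interpolation between derivatives *)

Section interpolation.
Context (R : realType) (n : nat).
Implicit Types (phi : schwartz R n) (x t v : 'rV[R]_n) (k : nat) (s : seq 'I_n).
Notation sn := schwartz_seminorm.

(** Landau's inequality: a derivative is a difference quotient of step [a] up to its own oscillation
    over a distance [a], which one more derivative controls. The powers of 2 come from 1 + a <=
    2. *)
Lemma seminorm_landau k i s phi (a : R) : 0 < a <= 1 ->
  sn k (i :: s) phi <=
  2 * ((2 ^+ k + 1) / a * sn k s phi + 2 * a * 2 ^+ k * grad_seminorm k (i :: s) phi).
Proof.
move=> /andP[a0 a1]; apply: seminorm_le => t; rewrite /weighted -/(wt t).
pose v : 'rV[R]_n := a *: delta_mx ord0 i.
have ev : enorm v = a.
  rewrite /v enormZ gtr0_norm// /enorm (bigD1 i)//= mxE !eqxx expr1n big1.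
    by rewrite addr0 sqrtr1 mulr1.
  by move=> j ji; rewrite mxE (negbTE ji) andbF expr0n.
have G0 := grad_seminorm_ge0 k (i :: s) phi.
have H (h : 'rV[R]_n -> R) : (forall x, differentiable h x) ->
    (forall x, `|h x| <= Normc.normc (pderivs s phi x)) ->
    (forall x x', `|'D_(delta_mx ord0 i) h x - 'D_(delta_mx ord0 i) h x'| <=
      Normc.normc (pderivs (i :: s) phi x - pderivs (i :: s) phi x')) ->
    wt t ^+ k * `|'D_(delta_mx ord0 i) h t| <=
    (2 ^+ k + 1) / a * sn k s phi + 2 * a * 2 ^+ k * grad_seminorm k (i :: s) phi.
  move=> dh h1 h2; have [c /andP[c0 c1] E] := mean_value t v dh.
  have {}E : h (t + v) - h t = a * 'D_(delta_mx ord0 i) h (t + c *: v).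
    rewrite E (bigD1 i)//= big1 => [|j ji].
      by rewrite /v !mxE !eqxx mulr1 addr0.
    by rewrite /v !mxE (negbTE ji) andbF mulr0 mul0r.
  have ecv : enorm (c *: v) <= a by rewrite enormZ ev ger0_norm// ler_piMl// ltW.
  have wt2 x : enorm x <= a -> wt x ^+ k <= 2 ^+ k.
    by move=> xa; rewrite lerXn2r ?nnegrE ?wt_ge0// /wt; lra.
  set Dc := 'D_(delta_mx ord0 i) h (t + c *: v) in E.
  set Dt := 'D_(delta_mx ord0 i) h t.
  have -> : Dt = Dc - (Dc - Dt) by rewrite opprB addrC subrK.
  apply: le_trans (_ : wt t ^+ k * `|Dc| + wt t ^+ k * `|Dc - Dt| <= _).
    by rewrite -mulrDr ler_wpM2l ?wtX_ge0// ler_normB.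
  apply: lerD.
    have -> : Dc = (h (t + v) - h t) / a by rewrite E mulrC mulKf// gt_eqF.
    rewrite normrM normfV (gtr0_norm a0) mulrA [in leRHS]mulrAC.
    rewrite ler_wpM2r ?invr_ge0 ?(ltW a0)//.
    apply: le_trans (_ : wt t ^+ k * (`|h (t + v)| + `|h t|) <= _).
      by rewrite ler_wpM2l ?wtX_ge0// ler_normB.
    rewrite mulrDr mulrDl mul1r; apply: lerD.
      apply: le_trans (_ : wt t ^+ k * Normc.normc (pderivs s phi (t + v)) <= _).
        by rewrite ler_wpM2l ?wtX_ge0.
      apply: le_trans (_ : 2 ^+ k * (wt (t + v) ^+ k * Normc.normc (pderivs s phi (t + v))) <= _).
        rewrite mulrA ler_wpM2r ?normc_ge0//.
        rewrite {1}(_ : t = - v + (t + v)); last by rewrite addrCA addNr addr0.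
        rewrite (le_trans (wtXD _ _ _))// ler_wpM2r ?wtX_ge0//.
        by rewrite wtN wt2// ev.
      by rewrite ler_wpM2l ?exprn_ge0// le_seminorm.
    apply: le_trans (le_seminorm k s phi t).
    by rewrite ler_wpM2l ?wtX_ge0.
  apply: le_trans (_ : wt t ^+ k *
    Normc.normc (pderivs (i :: s) phi (t + c *: v) - pderivs (i :: s) phi t) <= _).
    by rewrite ler_wpM2l ?wtX_ge0//; exact: h2.
  rewrite (le_trans (schwartz_lipschitz _ _ _ _ _))// ler_wpM2r//.
  by rewrite ler_pM ?mulr_ge0 ?enorm_ge0 ?wtX_ge0 ?ler_wpM2l// wt2.
have sp := schwartz_smooth phi s.
have Hr := H (@complex.Re R \o pderivs s phi) (fun x => (sp x).1)
  (fun x => @Re_le_normc R (pderivs s phi x))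
  (fun x x' => @Re_le_normc R (pderivs (i :: s) phi x - pderivs (i :: s) phi x')).
have Hi := H (@complex.Im R \o pderivs s phi) (fun x => (sp x).2)
  (fun x => @Im_le_normc R (pderivs s phi x))
  (fun x x' => @Im_le_normc R (pderivs (i :: s) phi x - pderivs (i :: s) phi x')).
apply: le_trans (_ : wt t ^+ k * (`|complex.Re (pderivs (i :: s) phi t)| +
   `|complex.Im (pderivs (i :: s) phi t)|) <= _).
  by rewrite ler_wpM2l ?wtX_ge0// normc_le_ReIm.
by rewrite mulrDr; move: Hr Hi => /=; lra.
Qed.

(* On a bounded subset of the Schwartz space, the Schwartz topology is that of
   locally uniform convergence. *)
Lemma bounded_locally_uniform_small (M : nat -> seq 'I_n -> R) k s (e : R) : 0 < e ->
  exists L d : R, [/\ 0 < L, 0 < d & forall phi,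
    (forall k s, sn k s phi <= M k s) ->
    (forall t, enorm t <= L -> Normc.normc (phi t) <= d) -> sn k s phi <= e].
Proof.
elim: s => [|i s IH] in k e *; move=> e0.
  pose m := `|M k.+1 [::]| + 1; have m0 : 0 < m by rewrite ltr_pwDr.
  have L0 : 0 < m / e by rewrite divr_gt0.
  have L1 : 0 < 1 + m / e by rewrite ltr_pwDl// ltW.
  (* Beyond the radius m/e the seminorm with one more power of the weight suffices. Inside, the
     weight is at most 1 + m/e and the second witness compensates its k-th power. *)
  exists (m / e), (e / (1 + m / e) ^+ k); split; rewrite ?divr_gt0 ?exprn_gt0//.
  move=> phi HM Hd; apply: seminorm_le => t; rewrite /weighted -/(wt t) /=.
  have [tL|tL] := leP (enorm t) (m / e).
    apply: le_trans (_ : (1 + m / e) ^+ k * (e / (1 + m / e) ^+ k) <= _); last first.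
      by rewrite mulrCA divff ?mulr1// expf_neq0 ?gt_eqF.
    apply: ler_pM; rewrite ?wtX_ge0 ?normc_ge0//; last exact: Hd.
    by rewrite lerXn2r ?nnegrE ?wt_ge0 ?(ltW L1)// lerD2l.
  have wtL : m / e <= wt t by rewrite /wt; lra.
  rewrite -(ler_pM2l (wt_gt0 t)) mulrA -exprS.
  have := le_seminorm k.+1 [::] phi t => /= /le_trans; apply.
  apply: le_trans (HM _ _) _; apply: le_trans (_ : m <= _).
    by rewrite (le_trans (ler_norm _))// lerDl.
  by rewrite -ler_pdivrMr.
pose m := `|\sum_(j < n) M k (j :: i :: s)| + 1.
have m0 : 0 < m by rewrite ltr_pwDr.
have k0 : 0 < 2 ^+ k :> R by rewrite exprn_gt0.
(* The step [a] makes the term of [seminorm_landau] with the extra derivative at most e/4; the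
   induction hypothesis is then used with a tolerance that does the same for the other term. *)
pose a := Num.min 1 (e / (8 * 2 ^+ k * m)).
have a0 : 0 < a by rewrite lt_min ltr01 divr_gt0// !mulr_gt0.
have a1 : a <= 1 by rewrite ge_min lexx.
have am : 8 * a * 2 ^+ k * m <= e.
  rewrite (_ : 8 * a * 2 ^+ k * m = a * (8 * 2 ^+ k * m)); last by ring.
  by rewrite -ler_pdivlMr ?mulr_gt0// ge_min lexx orbT.
have e'0 : 0 < e * a / (4 * (2 ^+ k + 1)) by rewrite !(divr_gt0,mulr_gt0)// addr_gt0.
have [L [d [L0 d0 H]]] := IH k _ e'0.
exists L, d; split => // phi HM Hd.
apply: le_trans (@seminorm_landau k i s phi a _) _; first by rewrite a0.
have {}H := H _ HM Hd.
have G : grad_seminorm k (i :: s) phi <= m.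
  apply: le_trans (_ : `|\sum_(j < n) M k (j :: i :: s)| <= _); last by rewrite lerDl.
  by apply: le_trans (ler_norm _); apply: ler_sum => j _; exact: HM.
have H1 : (2 ^+ k + 1) / a * sn k s phi <= e / 4.
  apply: le_trans (_ : (2 ^+ k + 1) / a * (e * a / (4 * (2 ^+ k + 1))) <= _).
    by rewrite ler_wpM2l// divr_ge0 ?(ltW a0)// addr_ge0// ltW.
  rewrite le_eqVlt; apply/orP; left; apply/eqP; field.
  by rewrite !gt_eqF ?addr_gt0.
have H2 : 2 * a * 2 ^+ k * grad_seminorm k (i :: s) phi <= e / 4.
  apply: le_trans (_ : 2 * a * 2 ^+ k * m <= _); last by move: am; rewrite -!mulrA; lra.
  by rewrite ler_wpM2l// !mulr_ge0 ?(ltW a0)// ltW.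
by move: H1 H2; lra.
Qed.

End interpolation.

(** * Size and continuity of wave packets *)

Section wave_packets.
Context (R : realType) (n : nat).
Implicit Types (phi : schwartz R n) (x t v : 'rV[R]_n) (y : R) (k : nat) (s : seq 'I_n).
Notation sn := schwartz_seminorm.

(* [t |-> y^-n phi ((t - x) / y)], so that [phi_transform f phi p] is
   [f (atom phi p)] by conversion *)
Definition atom phi (p : 'rV[R]_n * R) : schwartz R n :=
  (p.2^-1 ^+ n)%:C%C *: sdilate p.1 p.2 phi.

Lemma atomE phi x y t : 0 < y ->
  atom phi (x, y) t = (y^-1 ^+ n)%:C%C * phi (y^-1 *: (t - x)).
Proof.
move=> y0; have := @pderivs_schwartzZ R n [::] (y^-1 ^+ n)%:C%C (sdilate x y phi) t.
by rewrite /= sdilateE.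
Qed.

Lemma seminorm_atom k s phi x y : 0 < y <= 1 ->
  sn k s (atom phi (x, y)) <= y^-1 ^+ (n + size s) * wt x ^+ k * sn k s phi.
Proof.
move=> y01; have /andP[y0 y1] := y01; have V0 : 0 <= y^-1 by rewrite invr_ge0 ltW.
apply: le_trans (seminormZ_le _ _ _ _) _; rewrite normc_real ger0_norm ?exprn_ge0//=.
rewrite exprD -!mulrA ler_wpM2l ?exprn_ge0// mulrA [X in _ <= X * _]mulrC.
exact: seminorm_sdilate.
Qed.

Lemma atom_close phi x y k s (e : R) : 0 < y <= 1 -> 0 < e ->
  exists2 d : R, 0 < d & forall x' y', ball x d x' -> `|y - y'| < d -> 0 < y' <= 1 ->
    sn k s (atom phi (x', y') - atom phi (x, y)) <= e.
Proof.
move=> y01 e0; have /andP[y0 y1] := y01.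
have V0 : 0 < y^-1 by rewrite invr_gt0.
(* Each of the two packets obeys half of this bound, because 1/y' <= 2/y and wt x' <= (n + 1) wt x
   for nearby parameters. *)
pose M k s := 2 * ((2 / y) ^+ (n + size s) * (wt x * n.+1%:R) ^+ k * sn k s phi).
have [L [d [L0 d0 H]]] := bounded_locally_uniform_small M k s e0.
pose A := (2 / y) ^+ n; pose G := grad_seminorm 0 [::] phi; pose X := L + enorm x + n%:R.
have A0 : 0 <= A by rewrite exprn_ge0// mulr_ge0// ltW.
have G0 : 0 <= G by exact: grad_seminorm_ge0.
have X0 : 0 <= X by rewrite !addr_ge0 ?enorm_ge0// ltW.
have B0 : 0 <= sn 0 [::] phi by exact: seminorm_ge0.
(* [K] collects the coefficients of [r] in the final pointwise bound; the added 1 makes it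
   positive. *)
pose K := 2 * A * G * X + 2 * A * G * (y^-1 * n%:R) + sn 0 [::] phi + 1.
have K0 : 0 < K by rewrite ltr_pwDr// !addr_ge0// !mulr_ge0// ltW.
pose r := Num.min 1 (d / K).
have r0 : 0 < r by rewrite lt_min ltr01 divr_gt0.
have rK : r * K <= d by rewrite -ler_pdivlMr// ge_min lexx orbT.
have r1 : r <= 1 by rewrite ge_min lexx.
clearbody r.
have cV : {for y, continuous (fun u : R => u^-1)} by apply: inv_continuous; rewrite gt_eqF.
have cVn : {for y, continuous (fun u : R => u^-1 ^+ n)}.
  apply: (@continuous_comp _ _ _ (fun u : R => u^-1) (fun u => u ^+ n)) => //.
  exact: exprn_continuous.
have /cvgr_dist_lt/(_ _ r0)/nbhs_ballP[d1 /= d10 H1] := cV.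
have /cvgr_dist_lt/(_ _ r0)/nbhs_ballP[d2 /= d20 H2] := cVn.
exists (Num.min (Num.min r (y / 2)) (Num.min d1 d2)).
  by rewrite !lt_min r0 d10 d20 divr_gt0.
move=> x' y' xx' yy' y'01; have /andP[y'0 y'1] := y'01.
have [yr [y2 [yd1 yd2]]] : `|y - y'| < r /\ `|y - y'| < y / 2 /\ `|y - y'| < d1 /\ `|y - y'| < d2.
  by move: yy'; rewrite !lt_min => /andP[/andP[-> ->] /andP[-> ->]].
have xr : ball x r x'.
  by apply: le_ball xx'; rewrite !ge_min lexx.
have exx' : enorm (x' - x) <= n%:R * r by exact: enorm_le_ball.
have exn : enorm (x' - x) <= n%:R by rewrite (le_trans exx')// ler_piMr.
have y'y : y / 2 <= y' by move: y2; rewrite ltr_norml => /andP[]; lra.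
have V'2 : y'^-1 <= 2 / y.
  by rewrite -[2 / y]invrK lef_pV2 ?posrE ?invr_gt0 ?divr_gt0// invf_div.
have V2 : y^-1 <= 2 / y by rewrite ler_peMl ?(ltW V0)// ler1n.
have V'0 : 0 < y'^-1 by rewrite invr_gt0.
apply: H.
  move=> k' s'; apply: le_trans (seminormB _ _ _ _) _; rewrite /M mulr_natl mulr2n.
  have wx' : wt x' <= wt x * n.+1%:R.
    rewrite -(subrK x x') addrC (le_trans (wtD _ _))// ler_wpM2l ?wt_ge0//.
    by rewrite /wt -natr1 addrC lerD2r.
  apply: lerD; apply: le_trans (seminorm_atom _ _ _ _ _) _ => //; rewrite ler_wpM2r ?seminorm_ge0//.
    rewrite ler_pM ?exprn_ge0 ?wt_ge0 ?(ltW V'0)// lerXn2r ?nnegrE//.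
    - exact: ltW.
    - by rewrite mulr_ge0// ltW.
    - exact: wt_ge0.
    - by rewrite mulr_ge0// wt_ge0.
  rewrite ler_pM ?exprn_ge0 ?wt_ge0 ?(ltW V0)// lerXn2r ?nnegrE ?mulr_ge0 ?wt_ge0 ?(ltW V0)//.
  by rewrite ler_peMr ?wt_ge0// ler1n.
move=> t tL.
have -> : (atom phi (x', y') - atom phi (x, y)) t = atom phi (x', y') t - atom phi (x, y) t.
  exact: (pderivs_schwartzB [::]).
rewrite !atomE//; set u := y^-1 *: _; set u' := y'^-1 *: _.
set c := y^-1 ^+ n; set c' := y'^-1 ^+ n.
have -> : c'%:C%C * phi u' - c%:C%C * phi u = c'%:C%C * (phi u' - phi u) + (c' - c)%:C%C * phi u.
  by rewrite rmorphB /=; ring.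
apply: le_trans (le_normcD _ _) _; rewrite !Normc.normcM !normc_real.
have c'0 : 0 <= c' by rewrite exprn_ge0// ltW.
have c'A : c' <= A by rewrite /A lerXn2r ?nnegrE// ltW// divr_gt0.
have cc : `|c' - c| <= r by rewrite distrC ltW// H2.
have uu : enorm (u' - u) <= r * X + y^-1 * n%:R * r.
  have -> : u' - u = (y'^-1 - y^-1) *: (t - x') + y^-1 *: (x - x').
    by apply/rowP => i; rewrite !mxE; ring.
  apply: le_trans (enormD _ _) _; rewrite !enormZ; apply: lerD.
    apply: ler_pM; rewrite ?enorm_ge0//; first by rewrite distrC ltW// H1.
    rewrite (_ : t - x' = t + (- x - (x' - x))); last first.
      by apply/rowP => i; rewrite !mxE; ring.
    apply: le_trans (enormD _ _) _; rewrite /X -addrA lerD//.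
    by apply: le_trans (enormD _ _) _; rewrite !enormN lerD.
  by rewrite gtr0_norm// -mulrA ler_wpM2l ?(ltW V0)// -enormN opprB.
have lip : Normc.normc (phi u' - phi u) <= 2 * enorm (u' - u) * G.
  have := schwartz_lipschitz 0 [::] phi u (u' - u).
  by rewrite !expr0 mul1r mulr1 (addrC u) subrK.
apply: le_trans rK; rewrite ger0_norm//.
apply: le_trans (_ : A * (2 * (r * X + y^-1 * n%:R * r) * G) + r * sn 0 [::] phi <= _).
  apply: lerD; last by apply: ler_pM => //; [exact: normc_ge0|exact: (normc_le_seminorm [::])].
  apply: ler_pM; rewrite ?normc_ge0//; apply: le_trans lip _.
  by rewrite ler_wpM2r// ler_wpM2l.
rewrite /K; nra.
Qed.

End wave_packets.

(** * Decay of Schwartz functions against the weight *)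

Section decay.
Context (R : realType) (n : nat).
Implicit Types (phi rho : schwartz R n) (x t z : 'rV[R]_n) (y : R) (k : nat) (s : seq 'I_n).
Notation sn := schwartz_seminorm.
Notation W := (@cauchy_weight R n).
Notation mu := (lebesgue_row R n).

Lemma wt_cauchy_weight x : 1 <= wt x ^+ (2 * n) * W x.
Proof.
rewrite exprM /W -[X in _ ^+ X]card_ord -prodr_const -big_split/=.
have H (i : 'I_n) : 1 <= wt x ^+ 2 * (1 + x ord0 i ^+ 2)^-1.
  rewrite ler_pdivlMr ?ltr_pwDl ?sqr_ge0// mul1r /wt.
  have := ler_coord_enorm x i; have := enorm_ge0 x.
  move: (enorm x) => a a0 xa; have : x ord0 i ^+ 2 <= a ^+ 2.
    by rewrite -real_normK ?num_real// lerXn2r ?nnegrE.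
  nra.
rewrite -[leLHS](@big1 _ 1 *%R _ (index_enum 'I_n) predT (fun=> 1))// ler_prod// => i _.
by rewrite ler01 H.
Qed.

(** 2n spare powers of [wt] pay for the integrable factor [W]. This is the origin of the indices k +
    2n and l + 2n below. *)
Lemma schwartz_decay k s phi x :
  wt x ^+ k * Normc.normc (pderivs s phi x) <= sn (k + 2 * n) s phi * W x.
Proof.
have W0 := cauchy_weight_gt0 x.
apply: le_trans (_ : wt x ^+ (k + 2 * n) * Normc.normc (pderivs s phi x) * W x <= _).
  rewrite exprD -!mulrA ler_wpM2l ?wtX_ge0// mulrCA ler_peMr ?normc_ge0//.
  exact: wt_cauchy_weight.
by rewrite ler_wpM2r ?(ltW W0)// le_seminorm.
Qed.

(* A constant [K] for which the quadrature formula applies to the product of a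
   Schwartz function [phi] with a function bounded by [b] and [l]-Lipschitz. *)
Definition quad_const phi (b l : R) : R :=
  sn (2 * n) [::] phi * (b + l) +
  2 * n%:R * n.+1%:R ^+ (2 * n) * grad_seminorm (2 * n) [::] phi * b.

Lemma quad_const_ge0 phi b l : 0 <= b -> 0 <= l -> 0 <= quad_const phi b l.
Proof.
move=> b0 l0; rewrite addr_ge0 ?mulr_ge0 ?seminorm_ge0 ?grad_seminorm_ge0 ?addr_ge0// ?exprn_ge0//.
Qed.

(** Product rule for differences, changing one factor at a time; in both terms the decay of [phi] or
    of its gradient supplies the factor [W x]. *)
Lemma quad_const_product phi (g : 'rV[R]_n -> R[i]) (b l : R) : 0 <= b -> 0 <= l ->
  (forall x, Normc.normc (g x) <= b) ->
  (forall x e x', 0 < e <= 1 -> ball x e x' -> Normc.normc (g x - g x') <= l * e) ->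
  (forall x, Normc.normc (phi x * g x) <= quad_const phi b l * W x) /\
  (forall x (e : R) x', 0 < e <= 1 -> ball x e x' ->
    Normc.normc (phi x * g x - phi x' * g x') <= quad_const phi b l * e * W x).
Proof.
move=> b0 l0 gb gl; have W0 x := ltW (@cauchy_weight_gt0 R n x).
have dec x : Normc.normc (phi x) <= sn (2 * n) [::] phi * W x.
  by have := schwartz_decay 0 [::] phi x; rewrite expr0 mul1r.
have s0 := seminorm_ge0 (2 * n) [::] phi; have G0 := grad_seminorm_ge0 (2 * n) [::] phi.
pose c : R := 2 * n%:R * n.+1%:R ^+ (2 * n).
have c0 : 0 <= c by rewrite mulr_ge0// exprn_ge0.
split=> [x|x e x' e01 xx'].
  rewrite Normc.normcM; apply: le_trans (_ : sn (2 * n) [::] phi * W x * b <= _).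
    by rewrite ler_pM ?normc_ge0.
  rewrite mulrAC ler_wpM2r// /quad_const mulrDr -!addrA lerDl addr_ge0 ?mulr_ge0//.
have /andP[e0 e1] := e01.
rewrite (_ : _ - _ = - ((phi x' - phi x) * g x') + phi x * (g x - g x')); last by ring.
apply: le_trans (le_normcD _ _) _; rewrite normcN !Normc.normcM.
have xn : enorm (x' - x) <= n%:R * e by exact: enorm_le_ball.
have lip : Normc.normc (phi x' - phi x) <= c * e * grad_seminorm (2 * n) [::] phi * W x.
  apply: le_trans (_ : wt x ^+ (2 * n) * Normc.normc (phi x' - phi x) * W x <= _).
    by rewrite mulrAC ler_peMl ?normc_ge0// wt_cauchy_weight.
  rewrite ler_wpM2r//; have := schwartz_lipschitz (2 * n) [::] phi x (x' - x).
  rewrite /= [x + _]addrC subrK => /le_trans; apply; rewrite ler_wpM2r// /c.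
  rewrite -[leRHS]mulrA [X in _ <= _ * X]mulrC mulrA; apply: ler_pM.
  - by rewrite mulr_ge0 ?enorm_ge0.
  - exact: wtX_ge0.
  - by rewrite -mulrA ler_wpM2l.
  - rewrite lerXn2r ?nnegrE ?wt_ge0// /wt -natr1 addrC lerD2r (le_trans xn)//.
    by rewrite ler_piMr.
apply: le_trans (_ : c * e * grad_seminorm (2 * n) [::] phi * W x * b +
   sn (2 * n) [::] phi * W x * (l * e) <= _).
  by apply: lerD; apply: ler_pM; rewrite ?normc_ge0//; exact: gl.
have := mulr_ge0 (mulr_ge0 s0 b0) (mulr_ge0 (ltW e0) (W0 x)).
by rewrite /quad_const -/c; lra.
Qed.

End decay.

(** * Two Riemann sums of the convolution *)

Section smoothing.
Context (R : realType) (n : nat).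
Implicit Types (phi rho : schwartz R n) (x t : 'rV[R]_n) (y : R) (k : nat) (s : seq 'I_n).
Notation sn := schwartz_seminorm.
Notation W := (@cauchy_weight R n).
Notation mu := (lebesgue_row R n).

(** Riemann sum of the integral of phi(z) rho(t - y z) over z: the convolution phi_y * rho as an
    average of translates of [rho]. *)
Definition discrete_mollify phi N (w : nat -> R) (z : nat -> 'rV[R]_n) y rho : schwartz R n :=
  \sum_(i < N) ((w i)%:C%C * phi (z i)) *: sdilate (y *: z i) 1 rho.

(** Riemann sum of the same convolution, now as a superposition of wave packets with coefficients
    rho(z). *)
Definition discrete_synthesis phi N (w : nat -> R) (z : nat -> 'rV[R]_n) y rho : schwartz R n :=
  \sum_(i < N) ((w i)%:C%C * rho (z i)) *: atom phi (z i, y).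

Section weights.
Variables (N : nat) (w : nat -> R) (z : nat -> 'rV[R]_n) (C : R).
Hypotheses (w0 : forall i, 0 <= w i) (wC : \sum_(i < N) w i * W (z i) <= C).

Lemma sum_weight_decay phi k :
  \sum_(i < N) w i * (Normc.normc (phi (z i)) * wt (z i) ^+ k) <=
  C * sn (k + 2 * n) [::] phi.
Proof.
apply: le_trans (_ : (\sum_(i < N) w i * W (z i)) * sn (k + 2 * n) [::] phi <= _).
  rewrite mulr_suml; apply: ler_sum => i _; rewrite -mulrA ler_wpM2l// mulrC.
  by rewrite [leRHS]mulrC; exact: (schwartz_decay k [::] phi).
by rewrite ler_wpM2r ?seminorm_ge0.
Qed.

(** The bound is uniform in [y]: a translation by y z_i costs at most wt(z_i)^k, and the decay of
    [phi] absorbs it. *)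
Lemma seminorm_mollify phi y rho k s : 0 < y <= 1 ->
  sn k s (discrete_mollify phi N w z y rho) <= C * sn (k + 2 * n) [::] phi * sn k s rho.
Proof.
move=> /andP[y0 y1]; apply: le_trans (seminorm_sum _ _ _ _) _.
apply: le_trans (_ :
  (\sum_(i < N) w i * (Normc.normc (phi (z i)) * wt (z i) ^+ k)) * sn k s rho <= _).
  rewrite mulr_suml; apply: ler_sum => i _; apply: le_trans (seminormZ_le _ _ _ _) _.
  rewrite Normc.normcM normc_real ger0_norm// -!mulrA ler_wpM2l// ler_wpM2l ?normc_ge0//.
  apply: le_trans (seminorm_translate _ _ _ _) _; rewrite ler_wpM2r ?seminorm_ge0//.
  by rewrite lerXn2r ?nnegrE ?wt_ge0// wtZ_le// gtr0_norm.
by rewrite ler_wpM2r ?seminorm_ge0// sum_weight_decay.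
Qed.

(** The negative powers of [y] are harmless, since this bound only provides the boundedness required
    by the interpolation at a fixed [y]. *)
Lemma seminorm_synthesis phi y rho k s : 0 < y <= 1 ->
  sn k s (discrete_synthesis phi N w z y rho) <=
  C * sn (k + 2 * n) [::] rho * (y^-1 ^+ (n + size s) * sn k s phi).
Proof.
move=> y01; have /andP[y0 y1] := y01; apply: le_trans (seminorm_sum _ _ _ _) _.
have c0 : 0 <= y^-1 ^+ (n + size s) * sn k s phi.
  by rewrite mulr_ge0 ?seminorm_ge0// exprn_ge0// invr_ge0 ltW.
apply: le_trans (_ : (\sum_(i < N) w i * (Normc.normc (rho (z i)) * wt (z i) ^+ k)) *
    (y^-1 ^+ (n + size s) * sn k s phi) <= _).
  rewrite mulr_suml; apply: ler_sum => i _; apply: le_trans (seminormZ_le _ _ _ _) _.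
  rewrite Normc.normcM normc_real ger0_norm// -!mulrA ler_wpM2l// ler_wpM2l ?normc_ge0//.
  by apply: le_trans (seminorm_atom _ _ _ _ _) _; rewrite ?y01// -mulrA mulrCA.
by rewrite ler_wpM2r// sum_weight_decay.
Qed.

(** The difference consists of the defect of the discrete mass of [phi] from 1 and of an average of
    rho translated by y z_i minus rho. Both are O(y), the second at the cost of one derivative. *)
Lemma seminorm_mollifyB phi y rho k s : 0 < y <= 1 ->
  Normc.normc (\sum_(i < N) (w i)%:C%C * phi (z i) - 1) <= y ->
  sn k s (rho - discrete_mollify phi N w z y rho) <=
  (1 + 2 * (C * sn (k.+1 + 2 * n) [::] phi)) * y * (sn k s rho + grad_seminorm k s rho).
Proof.
move=> /andP[y0 y1]; set a := \sum_(i < N) _ => ay.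
have G0 := grad_seminorm_ge0 k s rho; have s0 := seminorm_ge0 k s rho.
have -> : rho - discrete_mollify phi N w z y rho = - ((a - 1) *: rho) -
    \sum_(i < N) ((w i)%:C%C * phi (z i)) *: (sdilate (y *: z i) 1 rho - rho).
  under eq_bigr => i _ do rewrite scalerBr.
  rewrite sumrB -scaler_suml -/a -/(discrete_mollify phi N w z y rho).
  by rewrite scalerBl scale1r !opprB addrA subrK.
apply: le_trans (seminormB _ _ _ _) _; rewrite seminormN.
have H1 : sn k s ((a - 1) *: rho) <= y * sn k s rho.
  by apply: le_trans (seminormZ_le _ _ _ _) _; rewrite ler_wpM2r.
have H2 : sn k s (\sum_(i < N) ((w i)%:C%C * phi (z i)) *: (sdilate (y *: z i) 1 rho - rho)) <=
    C * sn (k.+1 + 2 * n) [::] phi * (2 * y * grad_seminorm k s rho).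
  apply: le_trans (seminorm_sum _ _ _ _) _.
  apply: le_trans (_ : (\sum_(i < N) w i * (Normc.normc (phi (z i)) * wt (z i) ^+ k.+1)) *
      (2 * y * grad_seminorm k s rho) <= _); last first.
    by rewrite ler_wpM2r ?sum_weight_decay// !mulr_ge0// ltW.
  rewrite mulr_suml; apply: ler_sum => i _; apply: le_trans (seminormZ_le _ _ _ _) _.
  rewrite Normc.normcM normc_real ger0_norm// -!mulrA ler_wpM2l// ler_wpM2l ?normc_ge0//.
  apply: le_trans (seminorm_translateB _ _ _ _) _.
  (* One of the k + 1 powers of the weight absorbs the length of z_i in the displacement y z_i and
     leaves the factor y. *)
  rewrite [leRHS](_ : _ = 2 * (y * wt (z i)) * wt (z i) ^+ k * grad_seminorm k s rho); last first.
    by rewrite exprS; ring.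
  rewrite ler_wpM2r//; apply: ler_pM; rewrite ?wtX_ge0 ?mulr_ge0 ?enorm_ge0//.
    by rewrite ler_wpM2l// enormZ gtr0_norm// ler_wpM2l ?(ltW y0)// /wt lerDr.
  by rewrite lerXn2r ?nnegrE ?wt_ge0// wtZ_le// gtr0_norm.
have E0 : 0 <= C * sn (k.+1 + 2 * n) [::] phi.
  apply: le_trans (sum_weight_decay phi k.+1); apply: sumr_ge0 => i _.
  by rewrite !mulr_ge0 ?normc_ge0 ?wtX_ge0.
apply: le_trans (lerD H1 H2) _; set E := C * _ in E0 *.
have := mulr_ge0 (mulr_ge0 E0 (ltW y0)) s0; have := mulr_ge0 (ltW y0) G0; lra.
Qed.

End weights.

Lemma bounded_uniform_small (M : nat -> seq 'I_n -> R) (F : seq (nat * seq 'I_n)) (e : R) :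
  0 < e -> exists2 d : R, 0 < d & forall psi : schwartz R n,
    (forall k s, sn k s psi <= M k s) -> (forall t, Normc.normc (psi t) <= d) ->
    forall k s, (k, s) \in F -> sn k s psi <= e.
Proof.
move=> e0; elim: F => [|[k0 s0] F [d1 d10 H1]]; first by exists 1.
have [L [d [L0 d0 H]]] := bounded_locally_uniform_small M k0 s0 e0.
exists (Num.min d d1) => [|psi HM Hd k s]; first by rewrite lt_min d0.
rewrite inE => /predU1P[[-> ->]|ks].
  by apply: H => // t _; apply: le_trans (Hd t) _; rewrite ge_min lexx.
by apply: H1 => // t; apply: le_trans (Hd t) _; rewrite ge_min lexx orbT.
Qed.

End smoothing.

(** * Quadrature for complex integrands *)

Section complex_quadrature.
Context (R : realType) (n : nat).
Notation W := (@cauchy_weight R n).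
Notation mu := (lebesgue_row R n).
Implicit Types (g : 'rV[R]_n -> R[i]) (K : R).

Definition quad_admissible g K :=
  (forall x, Normc.normc (g x) <= K * W x) /\
  (forall x (e : R) x', 0 < e <= 1 -> ball x e x' ->
    Normc.normc (g x - g x') <= K * e * W x).

Lemma quad_admissible_continuous g K (h : 'rV[R]_n -> R) : 0 <= K ->
  quad_admissible g K -> (forall x x', `|h x - h x'| <= Normc.normc (g x - g x')) ->
  continuous h.
Proof.
move=> K0 [_ gL] hg x; apply/(@cvgrPdist_le _ _ _ (nbhs x) (nbhs_filter x)) => e e0.
have W0 := ltW (@cauchy_weight_gt0 R n x).
pose d := Num.min 1 (e / (K * W x + 1)).
have KW : 0 < K * W x + 1 by rewrite ltr_pwDr// mulr_ge0.
have d0 : 0 < d by rewrite lt_min ltr01 divr_gt0.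
apply/nbhs_ballP; exists d => //= x' xx'; apply: le_trans (hg x x') _.
apply: le_trans (gL x d x' _ xx') _; first by rewrite d0 ge_min lexx.
rewrite mulrAC mulrC; apply: le_trans (_ : d * (K * W x + 1) <= _).
  by rewrite ler_wpM2l ?(ltW d0)// lerDl.
by rewrite -ler_pdivlMr// ge_min lexx orbT.
Qed.

Lemma quad_admissible_Re g K : 0 <= K -> quad_admissible g K ->
  continuous (@complex.Re R \o g).
Proof.
by move=> K0 gK; apply: (quad_admissible_continuous K0 gK) => x x'; exact: Re_dist_normc.
Qed.

Lemma quad_admissible_Im g K : 0 <= K -> quad_admissible g K ->
  continuous (@complex.Im R \o g).
Proof.
by move=> K0 gK; apply: (quad_admissible_continuous K0 gK) => x x'; exact: Im_dist_normc.
Qed.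

(** Real and imaginary parts share the nodes and weights of [quadrature], each with error eta/2. *)
Lemma complex_quadrature : exists2 C : R, 0 <= C & forall eta : R, 0 < eta ->
  exists (N : nat) (w : nat -> R) (z : nat -> 'rV[R]_n),
  [/\ forall i, 0 <= w i, \sum_(i < N) w i * W (z i) <= C &
    forall g K, 0 <= K -> quad_admissible g K ->
      Normc.normc (\sum_(i < N) (w i)%:C%C * g (z i) - cintegral g) <= eta * K].
Proof.
have [C C0 H] := quadrature R n; exists C => // eta eta0.
have [N [w [z [w0 wC Q]]]] := H _ (divr_gt0 eta0 (ltr0n R 2)).
exists N, w, z; split => // g K K0 gQ; have [gK gL] := gQ.
have cr := quad_admissible_Re K0 gQ; have ci := quad_admissible_Im K0 gQ.
have Hr := Q (@complex.Re R \o g) K (continuous_measurable_row cr) K0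
  (fun x => le_trans (Re_le_normc _) (gK x))
  (fun x e x' e0 xx' => le_trans (Re_dist_normc (g x) (g x')) (gL x e x' e0 xx')).
have Hi := Q (@complex.Im R \o g) K (continuous_measurable_row ci) K0
  (fun x => le_trans (Im_le_normc _) (gK x))
  (fun x e x' e0 xx' => le_trans (Im_dist_normc (g x) (g x')) (gL x e x' e0 xx')).
apply: le_trans (normc_le_ReIm _) _.
have -> : \sum_(i < N) (w i)%:C%C * g (z i) =
  ((\sum_(i < N) w i * complex.Re (g (z i))) +i* (\sum_(i < N) w i * complex.Im (g (z i))))%C.
  elim: (index_enum 'I_N) => [|i r IH]; first by rewrite !big_nil.
  by rewrite !big_cons IH; case: (g (z i)) => u v; simpc.
rewrite /cintegral /=; move: Hr Hi => /=; lra.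
Qed.

Lemma cintegral_affine g K (y : R) (x : 'rV[R]_n) : 0 < y -> 0 <= K ->
  quad_admissible g K ->
  cintegral (fun t => g (y^-1 *: (x - t))) = (y ^+ n)%:C%C * cintegral g.
Proof.
move=> y0 K0 gQ; have [gK gL] := gQ.
have cr := quad_admissible_Re K0 gQ; have ci := quad_admissible_Im K0 gQ.
have H (h : 'rV[R]_n -> R) : continuous h -> (forall u, `|h u| <= Normc.normc (g u)) ->
    \int[mu]_t h (y^-1 *: (x - t)) = y ^+ n * \int[mu]_t h t.
  move=> ch hg.
  have ih : mu.-integrable setT (EFin \o h).
    apply: (@integrable_cauchy_dominated _ _ h K); first exact: continuous_measurable_row.
    by move=> u; exact: le_trans (hg u) (gK u).
  have fh : (\int[mu]_t (h t)%:E)%E \is a fin_num by exact: integrable_fin_num.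
  have mh : measurable_fun setT (fun t => (h t)%:E).
    by apply/measurable_EFinP; exact: continuous_measurable_row.
  have := @integral_affine R n y x (fun t => (h t)%:E) y0 mh fh.
  by rewrite /Rintegral => ->; rewrite fineM.
rewrite /cintegral; have -> := H (@complex.Re R \o g) cr (fun u => Re_le_normc _).
have -> := H (@complex.Im R \o g) ci (fun u => Im_le_normc _).
by simpc.
Qed.

End complex_quadrature.

(** * Comparison of the two sums and one smoothing step *)

Section smoothing_step.
Context (R : realType) (n : nat).
Implicit Types (phi rho : schwartz R n) (x t : 'rV[R]_n) (y c : R) (k : nat) (s : seq 'I_n).
Notation sn := schwartz_seminorm.
Notation W := (@cauchy_weight R n).

(** The value of [quad_const] for [u |-> phi u * rho (c *: (t - u))]. It does not involve [t], so
    the quadrature error is uniform in [t]. *)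
Definition affine_quad_const phi rho c : R :=
  quad_const phi (sn 0 [::] rho) (2 * c * n%:R * grad_seminorm 0 [::] rho).

Lemma affine_quad_const_ge0 phi rho c : 0 <= c -> 0 <= affine_quad_const phi rho c.
Proof.
by move=> c0; rewrite quad_const_ge0 ?seminorm_ge0// !mulr_ge0 ?grad_seminorm_ge0.
Qed.

Lemma quad_admissible_affine phi rho c t : 0 <= c ->
  quad_admissible (fun u => phi u * rho (c *: (t - u))) (affine_quad_const phi rho c).
Proof.
move=> c0; have l0 : 0 <= 2 * c * n%:R * grad_seminorm 0 [::] rho.
  by rewrite !mulr_ge0 ?grad_seminorm_ge0.
apply: (quad_const_product _ (seminorm_ge0 0 [::] rho) l0) => [x|x e x' e01 xx'].
  exact: (normc_le_seminorm [::]).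
have := schwartz_lipschitz 0 [::] rho (c *: (t - x')) (c *: (x' - x)).
rewrite !expr0 mul1r mulr1 -scalerDr addrA subrK /= => /le_trans; apply.
rewrite [leRHS]mulrAC ler_wpM2r ?grad_seminorm_ge0// -!mulrA ler_wpM2l// enormZ ger0_norm//.
by rewrite ler_wpM2l// enorm_le_ball.
Qed.

Lemma quad_admissible_schwartz phi : quad_admissible phi (quad_const phi 1 0).
Proof.
have [||H1 H2] := @quad_const_product R n phi (fun=> 1) 1 0 ler01 (lexx 0).
- by move=> x; rewrite normc_real normr1.
- by move=> *; rewrite subrr mul0r Normc.normc0.
by split=> [x|x e x' e0 xx']; [have := H1 x|have := H2 x e x' e0 xx']; rewrite !mulr1.
Qed.

(** Commutativity of the convolution, by the substitution u = (t - x)/y. *)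
Lemma cintegral_mollify phi rho y t : 0 < y ->
  cintegral (fun u => phi u * rho (y *: (y^-1 *: t - u))) =
  (y^-1 ^+ n)%:C%C * cintegral (fun x => rho x * phi (y^-1 *: (t - x))).
Proof.
move=> y0; set g := fun u => phi u * rho (y *: (y^-1 *: t - u)).
have := cintegral_affine t y0 (affine_quad_const_ge0 phi rho (ltW y0))
  (quad_admissible_affine phi rho (y^-1 *: t) (ltW y0)).
rewrite -/g => E; rewrite -[LHS]mul1r -[1](_ : (y^-1 ^+ n)%:C%C * (y ^+ n)%:C%C = _ :> R[i]).
  rewrite -mulrA -E; congr (_ * cintegral _); apply/funext => x.
  rewrite /g mulrC; congr (rho _ * _).
  by rewrite -scalerBr scalerA divff ?gt_eqF// scale1r opprB addrCA subrr addr0.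
by rewrite -rmorphM -exprMn mulVf ?gt_eqF// expr1n.
Qed.

(** Both sums approximate the same value of phi_y * rho at [t], with errors uniform in [t]. *)
Lemma mollify_synthesis_close phi rho y : 0 < y ->
  exists2 K : R, 0 <= K & forall (eta : R) N (w : nat -> R) (z : nat -> 'rV[R]_n), 0 < eta ->
    (forall g K', 0 <= K' -> quad_admissible g K' ->
      Normc.normc (\sum_(i < N) (w i)%:C%C * g (z i) - cintegral g) <= eta * K') ->
    forall t, Normc.normc (discrete_mollify phi N w z y rho t -
      discrete_synthesis phi N w z y rho t) <= eta * K.
Proof.
move=> y0; have V0 : 0 <= y^-1 by rewrite invr_ge0 ltW.
have K10 := affine_quad_const_ge0 phi rho (ltW y0).
have K20 := affine_quad_const_ge0 rho phi V0.
have Vn0 : 0 <= y^-1 ^+ n by rewrite exprn_ge0.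
exists (affine_quad_const phi rho y + y^-1 ^+ n * affine_quad_const rho phi y^-1).
  by rewrite addr_ge0// mulr_ge0.
move=> eta N w z eta0 Q t.
have -> : discrete_mollify phi N w z y rho t =
    \sum_(i < N) (w i)%:C%C * (phi (z i) * rho (y *: (y^-1 *: t - z i))).
  rewrite -[LHS]/(pderivs [::] _ t) pderivs_schwartz_sum; apply: eq_bigr => i _.
  rewrite pderivs_schwartzZ pderivs_translate /= -mulrA; congr (_ * (_ * rho _)).
  by rewrite scalerBr scalerA divff ?gt_eqF// scale1r.
have -> : discrete_synthesis phi N w z y rho t =
    (y^-1 ^+ n)%:C%C * \sum_(i < N) (w i)%:C%C * (rho (z i) * phi (y^-1 *: (t - z i))).
  rewrite -[LHS]/(pderivs [::] _ t) pderivs_schwartz_sum mulr_sumr; apply: eq_bigr => i _.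
  by rewrite pderivs_schwartzZ -[pderivs [::] _ t]/(atom phi (z i, y) t) atomE//; ring.
have H1 := Q _ _ K10 (quad_admissible_affine phi rho (y^-1 *: t) (ltW y0)).
have H2 := Q _ _ K20 (quad_admissible_affine rho phi t V0).
rewrite (cintegral_mollify _ _ _ y0) in H1.
set a := \sum_(i < N) _ in H1 *; set b := \sum_(i < N) _ in H2 *.
set I := cintegral _ in H1 H2.
rewrite (_ : a - _ = (a - (y^-1 ^+ n)%:C%C * I) - (y^-1 ^+ n)%:C%C * (b - I)); last by ring.
apply: le_trans (le_normcD _ _) _; rewrite normcN Normc.normcM normc_real ger0_norm//.
by rewrite mulrDr lerD// mulrCA ler_wpM2l.
Qed.

(** [C] and [D] depend on [phi] and n only, while the nodes may depend on [rho], [y], [F] and [e];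
    this is what permits iteration. *)
Lemma smoothing_step phi : cintegral phi = 1 ->
  exists2 C : R, 0 <= C & exists2 D : nat -> R, (forall k, 0 <= D k) &
  forall rho y (F : seq (nat * seq 'I_n)) (e : R), 0 < y <= 1 -> 0 < e ->
  exists (rho' : schwartz R n) (N : nat) (w : nat -> R) (z : nat -> 'rV[R]_n),
  [/\ forall i, 0 <= w i, \sum_(i < N) w i * W (z i) <= C,
    forall k s, sn k s rho' <= D k * sn k s rho,
    forall k s, sn k s rho' <= D k * y * (sn k s rho + grad_seminorm k s rho) &
    forall k s, (k, s) \in F ->
      sn k s (rho - rho' - discrete_synthesis phi N w z y rho) <= e].
Proof.
move=> phi1; have [C C0 HC] := complex_quadrature R n.
exists C => //; exists (fun k => 1 + C * sn (k + 2 * n) [::] phi +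
  2 * (C * sn (k.+1 + 2 * n) [::] phi)).
  by move=> k; rewrite !addr_ge0 ?mulr_ge0 ?seminorm_ge0.
move=> rho y F e y01 e0; have /andP[y0 y1] := y01.
pose M k s := C * sn (k + 2 * n) [::] phi * sn k s rho +
  C * sn (k + 2 * n) [::] rho * (y^-1 ^+ (n + size s) * sn k s phi).
have [d d0 Hd] := bounded_uniform_small M F e0.
have [K K0 HK] := mollify_synthesis_close phi rho y0.
have Kphi0 : 0 <= quad_const phi 1 0 by exact: quad_const_ge0.
(* Two demands on the quadrature: uniform closeness of the two sums within [d], and a discrete mass
   of [phi] within [y] of its integral 1. *)
pose eta := Num.min (d / (K + 1)) (y / (quad_const phi 1 0 + 1)).
have eta0 : 0 < eta by rewrite lt_min !divr_gt0// ltr_pwDr.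
have [N [w [z [w0 wC Q]]]] := HC _ eta0.
exists (rho - discrete_mollify phi N w z y rho), N, w, z; split => //.
- move=> k s; apply: le_trans (seminormB _ _ _ _) _.
  have := seminorm_mollify w0 wC phi rho k s y01.
  have := seminorm_ge0 k s rho.
  have := mulr_ge0 (mulr_ge0 C0 (seminorm_ge0 (k.+1 + 2 * n) [::] phi)) (seminorm_ge0 k s rho).
  lra.
- move=> k s; apply: le_trans (seminorm_mollifyB w0 wC _ _ _ y01 _) _.
    rewrite -phi1; apply: le_trans (Q _ _ Kphi0 (quad_admissible_schwartz phi)) _.
    apply: le_trans (_ : eta * (quad_const phi 1 0 + 1) <= _).
      by rewrite ler_wpM2l ?(ltW eta0)// lerDl.
    by rewrite -ler_pdivlMr ?ltr_pwDr// ge_min lexx orbT.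
  rewrite ler_wpM2r ?addr_ge0 ?seminorm_ge0 ?grad_seminorm_ge0//.
  rewrite ler_wpM2r ?(ltW y0)//.
  by rewrite -addrA lerD2l lerDr mulr_ge0 ?seminorm_ge0.
- apply: Hd.
    move=> k s; rewrite subKr; apply: le_trans (seminormB _ _ _ _) _; apply: lerD.
      exact: seminorm_mollify.
    exact: seminorm_synthesis.
  move=> t; rewrite subKr.
  have -> : (discrete_mollify phi N w z y rho - discrete_synthesis phi N w z y rho) t =
     discrete_mollify phi N w z y rho t - discrete_synthesis phi N w z y rho t.
    exact: (pderivs_schwartzB [::]).
  apply: le_trans (HK _ _ _ _ eta0 Q t) _.
  apply: le_trans (_ : eta * (K + 1) <= _).
    by rewrite ler_wpM2l ?(ltW eta0)// lerDl.
  by rewrite -ler_pdivlMr ?ltr_pwDr// ge_min lexx.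
Qed.

End smoothing_step.

(** * Seminorms that count lost derivatives *)

Section sobolev_seminorms.
Context (R : realType) (n : nat).
Implicit Types (phi rho : schwartz R n) (k m : nat) (s : seq 'I_n).
Notation sn := schwartz_seminorm.

(** Sum, with multiplicities, of the seminorms of all derivatives that add at most [m] directions to
    [s]. Losing a derivative is one step of this recursion. *)
Fixpoint sobolev k m s rho : R :=
  if m is m'.+1 then sobolev k m' s rho + \sum_(i < n) sobolev k m' (i :: s) rho
  else sn k s rho.

Lemma sobolev_ge0 k m s rho : 0 <= sobolev k m s rho.
Proof.
elim: m s => [|m IH] s /=; first exact: seminorm_ge0.
by rewrite addr_ge0// sumr_ge0.
Qed.

Lemma le_sobolev k m m' s rho : (m <= m')%N -> sobolev k m s rho <= sobolev k m' s rho.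
Proof.
move=> /subnKC <-; elim: (m' - m)%N => [|j IH]; first by rewrite addn0.
by rewrite addnS/= (le_trans IH)// lerDl sumr_ge0// => i _; exact: sobolev_ge0.
Qed.

Lemma sobolev_bound k (c : R) rho rho' :
  (forall s, sn k s rho' <= c * sn k s rho) ->
  forall m s, sobolev k m s rho' <= c * sobolev k m s rho.
Proof.
move=> H; elim=> [|m IH] s //=.
by rewrite mulrDr mulr_sumr lerD// ler_sum.
Qed.

Lemma sobolev_gain k (c : R) rho rho' :
  (forall s, sn k s rho' <= c * (sn k s rho + grad_seminorm k s rho)) ->
  forall m s, sobolev k m s rho' <= c * sobolev k m.+1 s rho.
Proof.
move=> H; elim=> [|m IH] s; first exact: H.
rewrite [sobolev k m.+2 s rho]/= -[X in c * (X + _)]/(sobolev k m.+1 s rho).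
by rewrite mulrDr mulr_sumr lerD// ler_sum.
Qed.

(** A finite sum of Schwartz seminorms is controlled by finitely many of them, so it can be made
    small by approximation in the Schwartz topology. *)
Lemma sobolev_small k m s : exists (F : seq (nat * seq 'I_n)) (c : R), 0 <= c /\
  forall rho (e : R), (forall k s, (k, s) \in F -> sn k s rho <= e) ->
    sobolev k m s rho <= c * e.
Proof.
elim: m s => [|m IH] s.
  exists [:: (k, s)], 1; split => // rho e H; rewrite mul1r /=; apply: H.
  by rewrite inE.
have [F [c [c0 Hc]]] := IH s.
have /choice[G /choice[d Hd]] : forall i : 'I_n,
  exists (G : seq (nat * seq 'I_n)), exists (d : R), 0 <= d /\
  forall rho (e : R), (forall k s, (k, s) \in G -> sn k s rho <= e) ->
    sobolev k m (i :: s) rho <= d * e by move=> i; exact: IH.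
exists (F ++ flatten [seq G i | i <- enum 'I_n]), (c + \sum_i d i); split.
  by rewrite addr_ge0// sumr_ge0// => i _; have [] := Hd i.
move=> rho e H /=; rewrite mulrDl mulr_suml; apply: lerD.
  by apply: Hc => k' s' ks; apply: H; rewrite mem_cat ks.
apply: ler_sum => i _; have [_ Hi] := Hd i; apply: Hi => k' s' ks.
apply: H; rewrite mem_cat; apply/orP; right; apply/flattenP; exists (G i) => //.
by apply/mapP; exists i => //; rewrite mem_enum.
Qed.

End sobolev_seminorms.

(** * Rapidly decreasing scales *)

Section superexponential.
Context (R : realType).

(* Faster than geometric decay absorbs the powers [D ^+ a] of the constants of the
   smoothing steps, while [scale a.+1 = scale a ^+ 2] lets a fixed number of
   gained powers of [scale a] pay for a given negative power of [scale a.+1]. *)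
Definition scale (a : nat) : R := 2^-1 ^+ (2 ^ a)%N.

Lemma scale_gt0 a : 0 < scale a. Proof. by rewrite exprn_gt0. Qed.

Lemma scale_le1 a : scale a <= 1.
Proof. by rewrite exprn_ile1// invf_le1// ler1n. Qed.

Lemma scaleS a : scale a.+1 = scale a ^+ 2.
Proof. by rewrite /scale expnSr exprM. Qed.

(** Comparison with 1/a! reduces every sum of terms scale(a) D^a to the exponential series. *)
Lemma scale_le_factV a : scale a <= a`!%:R^-1.
Proof.
rewrite /scale exprVn lef_pV2 ?posrE ?ltr0n ?fact_gt0 ?exprn_gt0//.
rewrite -natrX ler_nat; elim: a => // a IH.
rewrite factS expnSr expnM -mulnn leq_mul//.
apply: leq_ltn_trans (ltn_expl (2 ^ a) (isT : 1 < 2)%N); exact/ltnW/ltn_expl.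
Qed.

Lemma scale_exp_cvg0 (D : R) : scale a * D ^+ a @[a --> \oo] --> 0.
Proof.
have c0 := cvg_exp_coeff `|D|.
apply: norm_cvg0; apply: (squeeze_cvgr _ (cvg_cst 0) c0).
apply: nearW => a /=; rewrite normr_ge0/= normrM gtr0_norm ?scale_gt0// normrX.
by rewrite /exp_coeff mulrC ler_wpM2l ?exprn_ge0// scale_le_factV.
Qed.

Lemma sum_scale_exp (D : R) N : 0 <= D ->
  \sum_(a < N) scale a * D ^+ a <= expR D.
Proof.
move=> D0; apply: le_trans (_ : \sum_(a < N) exp_coeff D a <= _).
  by apply: ler_sum => a _; rewrite /exp_coeff mulrC ler_wpM2l ?exprn_ge0// scale_le_factV.
rewrite -(big_mkord xpredT (exp_coeff D)).
apply: (nondecreasing_cvgn_le _ (is_cvg_series_exp_coeff D)).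
by apply: nondecreasing_series => a _ _; exact: exp_coeff_ge0.
Qed.

End superexponential.

(** * Lifting to the Banach space *)

Section real_norm.
Context (R : realType) (E : normedModType R[i]).
Implicit Types e : E.

(** The norm of a module over [R[i]] is a complex number with zero imaginary part; estimates are
    carried out on its real part. *)
Definition rnorm e : R := complex.Re `|e|.

Lemma rnormE e : `|e| = (rnorm e)%:C%C.
Proof.
have := normr_ge0 e; rewrite /rnorm lecE /=.
by case: `|e| => a b /= /andP[/eqP -> _].
Qed.

Lemma rnormD e1 e2 : rnorm (e1 + e2) <= rnorm e1 + rnorm e2.
Proof. by have := ler_normD e1 e2; rewrite !rnormE -rmorphD lecR. Qed.

Lemma rnormZ (a : R[i]) e : rnorm (a *: e) = Normc.normc a * rnorm e.
Proof.
apply: (@complexI R); rewrite -rnormE normrZ rmorphM/= -rnormE.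
by rewrite norm_complexE.
Qed.

Lemma rnorm0 : rnorm 0 = 0. Proof. by rewrite /rnorm normr0. Qed.

Lemma rnorm_sum I (r : seq I) (F : I -> E) :
  rnorm (\sum_(i <- r) F i) <= \sum_(i <- r) rnorm (F i).
Proof.
elim: r => [|i r IH]; first by rewrite !big_nil rnorm0.
by rewrite !big_cons (le_trans (rnormD _ _))// lerD2l.
Qed.

End real_norm.

(** * Approximation by vectors whose image has bounded norm *)

Section approximation.
Context (R : realType) (n : nat) (X : lmodType R[i]) (E : normedModType R[i]).
Context (iota : {linear E -> X}) (f : {linear schwartz R n -> X}).
Implicit Types (phi rho psi : schwartz R n) (y c d : R) (k m : nat) (s : seq 'I_n).
Implicit Types (F : seq (nat * seq 'I_n)).
Notation sn := schwartz_seminorm.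

Definition reach c psi := exists2 e : E, f psi = iota e & rnorm e <= c.

Lemma reach0 : reach 0 0.
Proof. by exists 0; rewrite ?linear0 ?rnorm0. Qed.

Lemma reachD c d psi rho : reach c psi -> reach d rho -> reach (c + d) (psi + rho).
Proof.
move=> [e fe ec] [e' fe' ed]; exists (e + e'); first by rewrite !linearD fe fe'.
by rewrite (le_trans (rnormD _ _))// lerD.
Qed.

Lemma reachZ (a : R[i]) c psi : reach c psi -> reach (Normc.normc a * c) (a *: psi).
Proof.
move=> [e fe ec]; exists (a *: e); first by rewrite !linearZ/= fe.
by rewrite rnormZ ler_wpM2l ?normc_ge0.
Qed.

Lemma reach_le c d psi : c <= d -> reach c psi -> reach d psi.
Proof. by move=> cd [e fe ec]; exists e => //; exact: le_trans cd. Qed.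

(* [rho] lies in the closure of the set of the [psi] such that [reach c psi] *)
Definition near_reach c rho := forall F (e : R), 0 < e ->
  exists2 psi, reach c psi & forall k s, (k, s) \in F -> sn k s (rho - psi) <= e.

Lemma near_reach_le c d rho : c <= d -> near_reach c rho -> near_reach d rho.
Proof.
move=> cd H F e e0; have [psi rpsi Hpsi] := H F e e0.
by exists psi => //; exact: reach_le rpsi.
Qed.

Lemma near_reach0 : near_reach 0 0.
Proof.
move=> F e e0; exists 0; first exact: reach0.
by move=> k s _; rewrite subrr seminorm0 ltW.
Qed.

Lemma near_reachD c d rho rho' :
  near_reach c rho -> near_reach d rho' -> near_reach (c + d) (rho + rho').
Proof.
move=> H H' F e e0; have e20 : 0 < e / 2 by rewrite divr_gt0.
have [psi rpsi Hpsi] := H F _ e20; have [psi' rpsi' Hpsi'] := H' F _ e20.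
exists (psi + psi'); first exact: reachD.
move=> k s ks; rewrite opprD addrACA (le_trans (seminormD _ _ _ _))//.
by rewrite (splitr e) lerD ?Hpsi ?Hpsi'.
Qed.

Lemma near_reachZ (a : R[i]) c rho : near_reach c rho -> near_reach (Normc.normc a * c) (a *: rho).
Proof.
move=> H F e e0; have a1 : 0 < Normc.normc a + 1 by rewrite ltr_pwDr ?normc_ge0.
have [psi rpsi Hpsi] := H F _ (divr_gt0 e0 a1).
exists (a *: psi); first exact: reachZ.
move=> k s ks; rewrite -scalerBr (le_trans (seminormZ_le _ _ _ _))//.
apply: le_trans (_ : (Normc.normc a + 1) * (e / (Normc.normc a + 1)) <= _).
  by rewrite ler_pM ?normc_ge0 ?seminorm_ge0 ?lerDl ?Hpsi.
by rewrite mulrCA divff ?mulr1// gt_eqF.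
Qed.

Lemma near_reach_sum I (r : seq I) (c : I -> R) (rho : I -> schwartz R n) :
  (forall i, near_reach (c i) (rho i)) ->
  near_reach (\sum_(i <- r) c i) (\sum_(i <- r) rho i).
Proof.
move=> H; elim: r => [|i r IH]; first by rewrite !big_nil; exact: near_reach0.
by rewrite !big_cons; exact: near_reachD.
Qed.

Lemma atom_close_seq phi x y F (e : R) : 0 < y <= 1 -> 0 < e ->
  exists2 d : R, 0 < d & forall x' y', ball x d x' -> `|y - y'| < d -> 0 < y' <= 1 ->
    forall k s, (k, s) \in F -> sn k s (atom phi (x', y') - atom phi (x, y)) <= e.
Proof.
move=> y01 e0; elim: F => [|[k0 s0] F [d1 d10 H1]]; first by exists 1.
have [d2 d20 H2] := atom_close phi x k0 s0 y01 e0.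
exists (Num.min d1 d2) => [|x' y' xx' yy' y'01 k s]; first by rewrite lt_min d10.
rewrite inE => /predU1P[[-> ->]|ks].
  apply: H2 => //; last by rewrite (lt_le_trans yy')// ge_min lexx orbT.
  by apply: le_ball xx'; rewrite ge_min lexx orbT.
apply: H1 => //; last by rewrite (lt_le_trans yy')// ge_min lexx.
by apply: le_ball xx'; rewrite ge_min lexx.
Qed.

Section atoms.
Context (phi : schwartz R n) (C : R) (kappa l : nat).
Hypothesis C0 : 0 <= C.
Hypothesis good : ae_strip (fun p => reach (C * (wt p.1 ^+ l / p.2 ^+ kappa)) (atom phi p)).

(** Each packet is a limit of packets at good parameters, which are dense. Moving there costs (n +
    1)^l, from wt x' <= (n + 1) wt x, and 2^kappa, from y' >= y/2. *)
Lemma near_reach_atom x y : 0 < y <= 1 ->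
  near_reach (C * n.+1%:R ^+ l * 2 ^+ kappa * y^-1 ^+ kappa * wt x ^+ l) (atom phi (x, y)).
Proof.
move=> y01 F e e0; have /andP[y0 y1] := y01.
have [d d0 Hd] := atom_close_seq phi x F y01 e0.
pose r := Num.min (Num.min d 1) (y / 2).
have r0 : 0 < r by rewrite !lt_min d0 ltr01 divr_gt0.
have [rd r1 ry] : [/\ r <= d, r <= 1 & r <= y / 2].
  by rewrite /r !ge_min !lexx !orbT.
have [x' [y' [xx' /andP[yy' y'y] y'0 gd]]] := ae_strip_dense x good y01 r0.
clearbody r.
have y'01 : 0 < y' <= 1 by rewrite y'0 (le_trans y'y).
exists (atom phi (x', y')).
  apply: reach_le gd => /=; rewrite -!mulrA ler_wpM2l// [leLHS]mulrC -exprVn.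
  rewrite [leRHS](_ : _ = (2 * y^-1) ^+ kappa * (n.+1%:R * wt x) ^+ l); last first.
    by rewrite !exprMn; ring.
  apply: ler_pM; rewrite ?wtX_ge0 ?exprn_ge0 ?invr_ge0 ?(ltW y'0)//.
    rewrite lerXn2r ?nnegrE ?mulr_ge0 ?invr_ge0 ?(ltW y'0) ?(ltW y0)//.
    by rewrite -[2 * y^-1]invrK lef_pV2 ?posrE ?invr_gt0 ?divr_gt0// invf_div; lra.
  rewrite lerXn2r ?nnegrE ?mulr_ge0 ?wt_ge0// -(subrK x x') addrC mulrC.
  apply: le_trans (wtD _ _) _; rewrite ler_wpM2l ?wt_ge0// /wt -natr1 addrC lerD2r.
  by apply: le_trans (enorm_le_ball xx') _; rewrite ler_piMr.
move=> k s ks; rewrite -seminormN opprB; apply: Hd => //; first exact: le_ball xx'.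
by rewrite ger0_norm ?subr_ge0//; lra.
Qed.

(** The costs of the packets add up; their growth wt^l is absorbed by the decay of [rho], hence the
    seminorm of index l + 2n. *)
Lemma near_reach_synthesis M (w : nat -> R) (z : nat -> 'rV[R]_n) y rho (B : R) :
  (forall i, 0 <= w i) -> \sum_(i < M) w i * cauchy_weight (z i) <= B -> 0 < y <= 1 ->
  near_reach (C * n.+1%:R ^+ l * 2 ^+ kappa * B * y^-1 ^+ kappa * sn (l + 2 * n) [::] rho)
    (discrete_synthesis phi M w z y rho).
Proof.
move=> w0 wB y01; have /andP[y0 y1] := y01; set c := C * _ * _.
have c0 : 0 <= c * y^-1 ^+ kappa.
  by rewrite !mulr_ge0 ?exprn_ge0 ?invr_ge0 ?(ltW y0).
apply: (@near_reach_le (\sum_(i < M) Normc.normc ((w i)%:C%C * rho (z i)) *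
    (c * y^-1 ^+ kappa * wt (z i) ^+ l))); last first.
  by apply: near_reach_sum => i; apply: near_reachZ; exact: near_reach_atom.
rewrite [leRHS](_ : _ = c * y^-1 ^+ kappa * (B * sn (l + 2 * n) [::] rho)); last by ring.
apply: le_trans (ler_wpM2l c0 (sum_weight_decay w0 wB rho l)).
rewrite mulr_sumr; apply: ler_sum => i _.
rewrite Normc.normcM normc_real ger0_norm// le_eqVlt; apply/orP; left; apply/eqP.
by ring.
Qed.

End atoms.

(* [rho'] is what remains of [rho] after removing, up to an error small in finitely
   many seminorms, a part of cost [c]: it gains the factor [g] and loses [j]
   derivatives. *)
Definition decomposes c (D : nat -> R) (g : R) (j : nat) rho F (e : R) :=
  exists rho' psi, [/\ reach c psi,
    forall k m s, sobolev k m s rho' <= D k * sobolev k m s rho,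
    forall k m s, sobolev k m s rho' <= D k * g * sobolev k (j + m) s rho &
    forall k s, (k, s) \in F -> sn k s (rho - rho' - psi) <= e].

(** Two estimates of the final remainder are kept: one accumulates both gains and both losses of
    derivatives, the other uses mere boundedness of the first stage and loses only j'
    derivatives. *)
Lemma decomposes_trans c c' D D' (g g' : R) j j' rho F (e : R) :
  0 < e -> (forall k, 0 <= D' k) -> 0 <= g' -> decomposes c D g j rho F (e / 2) ->
  (forall rho', (forall k m s, sobolev k m s rho' <= D k * sobolev k m s rho) ->
    (forall k m s, sobolev k m s rho' <= D k * g * sobolev k (j + m) s rho) ->
    decomposes c' D' g' j' rho' F (e / 2)) ->
  exists rho' psi, [/\ reach (c + c') psi,
    forall k m s, sobolev k m s rho' <= D' k * D k * sobolev k m s rho,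
    forall k m s, sobolev k m s rho' <=
      D' k * D k * (g' * g) * sobolev k (j + (j' + m)) s rho,
    forall k m s, sobolev k m s rho' <= D' k * g' * (D k * sobolev k (j' + m) s rho) &
    forall k s, (k, s) \in F -> sn k s (rho - rho' - psi) <= e].
Proof.
move=> e0 D0 g0 [rho1 [psi1 [r1 b1 g1 F1]]] H.
have [rho2 [psi2 [r2 b2 g2 F2]]] := H rho1 b1 g1.
exists rho2, (psi1 + psi2); split; first exact: reachD.
- by move=> k m s; apply: le_trans (b2 k m s) _; rewrite -mulrA ler_wpM2l.
- move=> k m s; apply: le_trans (g2 k m s) _.
  rewrite [leRHS](_ : _ = D' k * g' * (D k * g * sobolev k (j + (j' + m)) s rho)); last by ring.
  by rewrite ler_wpM2l// mulr_ge0.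
- by move=> k m s; apply: le_trans (g2 k m s) _; rewrite ler_wpM2l// mulr_ge0.
- move=> k s ks.
  rewrite (_ : _ - _ = (rho - rho1 - psi1) + (rho1 - rho2 - psi2)); last first.
    by rewrite [RHS]addrACA subrKA -opprD.
  by rewrite (splitr e) (le_trans (seminormD _ _ _ _))// lerD ?F1 ?F2.
Qed.

(** * Iterated smoothing over decreasing scales *)

Section iteration.
Context (phi : schwartz R n) (C : R) (kappa l : nat).
Hypothesis C0 : 0 <= C.
Hypothesis good : ae_strip (fun p => reach (C * (wt p.1 ^+ l / p.2 ^+ kappa)) (atom phi p)).
Hypothesis phi1 : cintegral phi = 1.

Notation p0 := (sn (l + 2 * n) [::]).

(* One step [rho' = rho - phi_y * rho], discretized: it is bounded for each
   seminorm, and small of order [y] at the cost of one derivative. *)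
Lemma decomposes_step : exists2 C' : R, 0 <= C' & exists2 D : nat -> R, (forall k, 0 <= D k) &
  forall rho y F (e : R), 0 < y <= 1 -> 0 < e ->
    decomposes (C' * y^-1 ^+ kappa * p0 rho) D y 1 rho F e.
Proof.
have [B B0 [D D0 H]] := smoothing_step phi1.
exists (C * n.+1%:R ^+ l * 2 ^+ kappa * B); first by rewrite !mulr_ge0 ?exprn_ge0.
exists D => // rho y F e y01 e0; have e20 : 0 < e / 2 by rewrite divr_gt0.
have [rho' [M [w [z [w0 wB b g HF]]]]] := H rho y F _ y01 e20.
have [psi rpsi Hpsi] := near_reach_synthesis C0 good rho w0 wB y01 F e20.
exists rho', psi; split => //.
- by move=> k m s; exact: sobolev_bound.
- by move=> k m s; rewrite add1n; exact: sobolev_gain.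
- move=> k s ks; set T := discrete_synthesis _ _ _ _ _ _ in Hpsi HF.
  rewrite -(subrKA T) (splitr e) (le_trans (seminormD _ _ _ _))//.
  by rewrite lerD ?Hpsi ?HF.
Qed.

(** Repeating one scale j times gains y^j, while the cost keeps the single factor y^-kappa because
    each step is bounded for the seminorm [p0]. *)
Lemma decomposes_block j : exists2 C' : R, 0 <= C' & exists2 D : nat -> R, (forall k, 0 <= D k) &
  forall rho y F (e : R), 0 < y <= 1 -> 0 < e ->
    decomposes (C' * y^-1 ^+ kappa * p0 rho) D (y ^+ j) j rho F e.
Proof.
have [C1 C10 [D1 D10 H1]] := decomposes_step.
elim: j => [|j [C2 C20 [D2 D20 H2]]].
  exists 0 => //; exists (fun=> 1) => // rho y F e _ e0; exists rho, 0; split => //.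
  - by rewrite !mul0r; exact: reach0.
  - by move=> k m s; rewrite mul1r.
  - by move=> k m s; rewrite expr0 !mul1r.
  - by move=> k s _; rewrite subrr subr0 seminorm0 ltW.
(* The last step acts on the remainder of the first j, whose [p0] seminorm is at most D2 (l + 2n)
   times that of [rho]. *)
exists (C2 + C1 * D2 (l + 2 * n)%N); first by rewrite addr_ge0// mulr_ge0.
exists (fun k => D1 k * D2 k) => [k|rho y F e y01 e0]; first by rewrite mulr_ge0.
have /andP[y0 y1] := y01; have V0 : 0 <= y^-1 by rewrite invr_ge0 ltW.
have e20 : 0 < e / 2 by rewrite divr_gt0.
have [|rho' [psi [r b g _ HF]]] := decomposes_trans e0 D10 (ltW y0) (H2 rho y F _ y01 e20)
  (c' := C1 * D2 (l + 2 * n)%N * y^-1 ^+ kappa * p0 rho) (j' := 1%N).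
  move=> rho1 b1 _; have [rho2 [psi2 [r2 b2 g2 F2]]] := H1 rho1 y F _ y01 e20.
  exists rho2, psi2; split => //; apply: reach_le r2.
  rewrite -[C1 * D2 _ * _]mulrAC -[leRHS]mulrA ler_wpM2l ?mulr_ge0 ?exprn_ge0//.
  exact: (b1 (l + 2 * n)%N 0%N [::]).
exists rho', psi; split => //.
- by apply: reach_le r; rewrite !mulrDl.
- by move=> k m s; have := g k m s; rewrite exprS addnA addn1.
Qed.

(** The gain of the most recent block only; before any block it is 1. *)
Definition gain j (a : nat) : R := if a is a'.+1 then scale R a' ^+ j else 1.

(** Block b costs scale(b)^-kappa times [p0] of the current remainder. Using the last gain alone,
    and boundedness for the earlier blocks, keeps the loss at j derivatives for any number of
    blocks. *)
Lemma decomposes_iter j (C' : R) (D : nat -> R) : 0 <= C' -> (forall k, 0 <= D k) ->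
  (forall rho y F (e : R), 0 < y <= 1 -> 0 < e ->
    decomposes (C' * y^-1 ^+ kappa * p0 rho) D (y ^+ j) j rho F e) ->
  forall a rho F (e : R), 0 < e ->
    decomposes (C' * (\sum_(b < a) (scale R b)^-1 ^+ kappa * gain j b * D (l + 2 * n)%N ^+ b) *
      sobolev (l + 2 * n) j [::] rho) (fun k => D k ^+ a) (gain j a) j rho F e.
Proof.
move=> C'0 D0 H; elim=> [|a IH] rho F e e0.
  exists rho, 0; split => //.
  - by rewrite big_ord0 mulr0 mul0r; exact: reach0.
  - by move=> k m s; rewrite expr0 mul1r.
  - by move=> k m s; rewrite expr0 !mul1r le_sobolev// leq_addl.
  - by move=> k s _; rewrite subrr subr0 seminorm0 ltW.
have e20 : 0 < e / 2 by rewrite divr_gt0.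
have y01 : 0 < scale R a <= 1 by rewrite scale_gt0 scale_le1.
have V0 : 0 <= (scale R a)^-1 by rewrite invr_ge0 ltW// scale_gt0.
pose c := C' * ((scale R a)^-1 ^+ kappa * gain j a * D (l + 2 * n)%N ^+ a) *
  sobolev (l + 2 * n) j [::] rho.
have [|rho' [psi [r b _ g HF]]] := decomposes_trans e0 D0
    (exprn_ge0 j (ltW (scale_gt0 R a))) (IH rho F _ e20) (c' := c) (j' := j).
  move=> rho1 _ g1; have [rho2 [psi2 [r2 b2 g2 F2]]] := H rho1 _ F _ y01 e20.
  exists rho2, psi2; split => //; apply: reach_le r2.
  rewrite /c [leRHS](_ : _ = C' * (scale R a)^-1 ^+ kappa *
    (D (l + 2 * n)%N ^+ a * gain j a * sobolev (l + 2 * n) j [::] rho)); last by ring.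
  rewrite ler_wpM2l ?mulr_ge0 ?exprn_ge0//.
  by have := g1 (l + 2 * n)%N 0%N [::]; rewrite addn0.
exists rho', psi; split => //.
- by apply: reach_le r; rewrite big_ord_recr/= /c mulrDr mulrDl.
- by move=> k m s; rewrite exprS; exact: b.
- by move=> k m s; rewrite [leRHS](_ : _ = D k * scale R a ^+ j *
    (D k ^+ a * sobolev k (j + m) s rho)) //= exprS; ring.
Qed.

Lemma near_reach_sobolev : exists2 C' : R, 0 <= C' &
  exists j, forall rho, near_reach (C' * sobolev (l + 2 * n) j [::] rho) rho.
Proof.
(* By [scaleS], scale(b+1)^-kappa is scale(b)^(-2 kappa). A gain of 2 kappa + 1 powers of scale(b)
   cancels this and leaves one power for summability. *)
pose j := (2 * kappa).+1.
have [C1 C10 [D D0 H]] := decomposes_block j.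
have iter := decomposes_iter C10 D0 H; set D1 := D (l + 2 * n)%N in iter.
have D10 : 0 <= D1 by exact: D0.
(* The term 2^kappa is the cost of the first block, at scale 1/2; the other costs are summed by
   [sum_scale_exp]. *)
exists (C1 * (2 ^+ kappa + D1 * expR D1)).
  by rewrite mulr_ge0// addr_ge0 ?mulr_ge0 ?exprn_ge0 ?expR_ge0.
exists j => rho F e e0; have e20 : 0 < e / 2 by rewrite divr_gt0.
(* After enough blocks the remainder is small in every seminorm of [F]: the decay of the scales
   beats the powers of [D k]. *)
have [a Ha] : exists a, forall k s, (k, s) \in F ->
    D k ^+ a.+1 * gain j a.+1 * sobolev k j s rho <= e / 2.
  have : \forall a \near \oo, forall k s, (k, s) \in F ->
    D k ^+ a.+1 * gain j a.+1 * sobolev k j s rho <= e / 2.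
    elim: F => [|[k0 s0] F IH]; first by apply: nearW.
    have c0 : scale R a * D k0 ^+ a * (D k0 * sobolev k0 j s0 rho) @[a --> \oo] --> 0.
      rewrite -[X in _ --> X](mul0r (D k0 * sobolev k0 j s0 rho)).
      by apply: cvgMl; exact: scale_exp_cvg0.
    move/cvgr0_norm_le/(_ _ e20) : c0 => c0.
    near=> a => k s; rewrite inE => /predU1P[[-> ->]|ks]; last first.
      by move: k s ks; near: a.
    apply: (@le_trans _ _ (scale R a * D k0 ^+ a * (D k0 * sobolev k0 j s0 rho))).
      rewrite -[gain j a.+1]/(scale R a ^+ j) exprSr.
      rewrite [leRHS](_ : _ = D k0 ^+ a * D k0 * scale R a * sobolev k0 j s0 rho);
        last by ring.
      rewrite ler_wpM2r ?sobolev_ge0// ler_wpM2l ?mulr_ge0 ?exprn_ge0//.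
      have sa0 := ltW (scale_gt0 R a).
      by rewrite exprS ler_piMr// exprn_ile1 ?scale_le1.
    by apply: le_trans (ler_norm _) _; near: a.
  by move=> [a _ /(_ a (leqnn a))] Ha; exists a.
have [rho' [psi [r _ g HF]]] := iter a.+1 rho F _ e20.
exists psi.
  apply: reach_le r; rewrite ler_wpM2r ?sobolev_ge0// ler_wpM2l//.
  rewrite big_ord_recl/= expr0 !mulr1; apply: lerD.
    by rewrite /scale expn0 expr1 invrK.
  apply: le_trans (_ : D1 * \sum_(b < a) scale R b * D1 ^+ b <= _).
    rewrite mulr_sumr; apply: ler_sum => b _; rewrite /bump /= add1n [D1 ^+ _]exprS.
    rewrite scaleS exprVn -exprM [scale R b ^+ j]exprS.
    rewrite [leLHS](_ : _ = (scale R b ^+ (2 * kappa))^-1 * scale R b ^+ (2 * kappa) *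
      (D1 * (scale R b * D1 ^+ b))); last by ring.
    by rewrite mulVf ?mul1r// gt_eqF// exprn_gt0// scale_gt0.
  by rewrite ler_wpM2l// sum_scale_exp.
move=> k s ks.
have -> : rho - psi = (rho - rho' - psi) + rho' by rewrite addrAC subrK.
rewrite (splitr e) (le_trans (seminormD _ _ _ _))// lerD ?HF//.
by apply: le_trans (Ha _ _ ks); have := g k 0%N s; rewrite addn0.
Unshelve. all: by end_near. Qed.

End iteration.

End approximation.

(** * Successive approximation in the complete space *)

Section completion.
Context (R : realType) (n : nat) (X : tvsType R[i]) (E : completeNormedModType R[i]).
Context (iota : {linear E -> X}) (f : {linear schwartz R n -> X}).
Hypothesis hausdorffX : hausdorff_space X.
Hypothesis iota_continuous : continuous iota.
Hypothesis f_continuous : continuous f.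
Implicit Types (rho psi : schwartz R n).
Notation sn := schwartz_seminorm.

Lemma geometric_tail m d : \sum_(m <= k < m + d) (2^-1 : R) ^+ k <= 2 * 2^-1 ^+ m.
Proof.
suff -> : \sum_(m <= k < m + d) (2^-1 : R) ^+ k = 2 * 2^-1 ^+ m - 2 * 2^-1 ^+ (m + d).
  by rewrite gerBl mulr_ge0// exprn_ge0.
elim: d => [|d IH]; first by rewrite addn0 big_geq// subrr.
by rewrite addnS big_nat_recr ?leq_addr//= IH exprS; field.
Qed.

(** Cauchy criterion. The bound starts at index 1, because the first correction in [lift_bounded] is
    only bounded by C P(rho). *)
Lemma geometric_series_cvg (u : nat -> E) :
  (forall k, (0 < k)%N -> rnorm (u k) <= 2^-1 ^+ k) -> cvgn (series u).
Proof.
move=> Hu; apply/cauchy_cvgP/cauchy_seriesP => e e0.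
have [e1 eE] : 0 < complex.Re e /\ e = (complex.Re e)%:C%C.
  by move: e0; rewrite ltcE /=; case: e => a b /= /andP[/eqP -> a0].
have : (2 * 2^-1 ^+ m : R) @[m --> \oo] --> (0 : R).
  rewrite -[X in _ --> X](mulr0 2); apply: cvgMr.
  by apply: cvg_expr; rewrite ger0_norm// invf_lt1// ltr1n.
move=> /cvgr0_norm_lt/(_ _ e1)[M _ HM].
exists ([set m | (maxn M 1 <= m)%N], setT).
  by split => /=; [exists (maxn M 1)|exact: filterT].
move=> [m p] /= [Mm _]; rewrite eE rnormE ltcR.
have Mm' : (M <= m)%N by apply: leq_trans Mm; exact: leq_maxl.
have m1 : (0 < m)%N by apply: leq_trans Mm; exact: leq_maxr.
have := HM m Mm' => /=; apply: le_lt_trans; apply: le_trans (ler_norm _).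
have [pm|mp] := leqP p m.
  by rewrite big_geq// rnorm0 mulr_ge0// exprn_ge0.
rewrite -(subnKC (ltnW mp)); apply: le_trans (geometric_tail m (p - m)).
apply: le_trans (rnorm_sum _ _) _; apply: ler_sum_nat => k /andP[mk _].
by apply: Hu; exact: leq_trans mk.
Qed.

Variables (C : R) (k0 m0 : nat).
Hypothesis C0 : 0 <= C.
Notation P := (sobolev k0 m0 [::]).
Hypothesis appr : forall rho, near_reach iota f (C * P rho) rho.

(** The third clause makes the next correction cheap. The last one runs through all seminorms by
    their codes, so that the successive remainders tend to 0 in the Schwartz space. *)
Lemma near_reach_refine j rho : exists psi (e : E), [/\ f psi = iota e, rnorm e <= C * P rho,
  C * P (rho - psi) <= 2^-1 ^+ j.+1 &
  forall k s, (pickle (k, s) <= j)%N -> sn k s (rho - psi) <= 2^-1 ^+ j].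
Proof.
have [F [c [c0 HF]]] := sobolev_small R k0 m0 ([::] : seq 'I_n).
have q0 i : 0 < (2^-1 : R) ^+ i by rewrite exprn_gt0.
pose e := Num.min (2^-1 ^+ j) (2^-1 ^+ j.+1 / (C * c + 1)).
have Cc : 0 < C * c + 1 by rewrite ltr_pwDr// mulr_ge0.
have e0 : 0 < e by rewrite lt_min q0 divr_gt0.
have [psi [v fv vC] Hpsi] := appr rho (F ++ pmap unpickle (seq.iota 0 j.+1)) e0.
exists psi, v; split => //.
  apply: le_trans (_ : C * (c * e) <= _).
    by rewrite ler_wpM2l// HF// => k s ks; apply: Hpsi; rewrite mem_cat ks.
  rewrite mulrA; apply: le_trans (_ : (C * c + 1) * e <= _).
    by rewrite ler_wpM2r ?(ltW e0)// lerDl.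
  by rewrite mulrC -ler_pdivlMr// ge_min lexx orbT.
move=> k s ks; apply: le_trans (Hpsi k s _) _; last by rewrite ge_min lexx.
rewrite mem_cat; apply/orP; right; rewrite mem_pmap; apply/mapP.
by exists (pickle (k, s)); rewrite ?pickleK// mem_iota add0n ltnS.
Qed.

Lemma schwartz_cvg (u : nat -> schwartz R n) rho :
  (forall k s (e : R), 0 < e -> \forall j \near \oo, sn k s (u j - rho) < e) ->
  u j @[j --> \oo] --> rho.
Proof.
move=> H A [F [e e0 FA]]; rewrite /nbhs/=.
have : \forall j \near \oo, forall k s, (k, s) \in F -> sn k s (u j - rho) < e.
  elim: F {FA} => [|[k s] F IH]; first by apply: nearW.
  have {}H := H k s e e0.
  near=> j => k' s'; rewrite inE => /predU1P[[-> ->]|ks]; first by near: j.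
  by move: k' s' ks; near: j.
by apply: filterS => j Hj; apply: FA => k s; exact: Hj.
Unshelve. all: by end_near. Qed.

(** The values of [f] at the partial sums come from a convergent series in [E]; their limit in [X]
    is unique. The additive constant covers the later corrections, at most 1 in total, and a
    distance below 1 from a partial sum to the limit. *)
Lemma lift_bounded rho : exists2 v : E, f rho = iota v & rnorm v <= C * P rho + 3.
Proof.
have /choice[Psi /choice[V HV]] : forall p : nat * schwartz R n, exists psi (e : E),
    [/\ f psi = iota e, rnorm e <= C * P p.2,
      C * P (p.2 - psi) <= 2^-1 ^+ p.1.+1 &
      forall k s, (pickle (k, s) <= p.1)%N -> sn k s (p.2 - psi) <= 2^-1 ^+ p.1].
  by move=> [j tau]; exact: near_reach_refine.
pose sigma := fix sigma (j : nat) : schwartz R n :=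
  if j is i.+1 then sigma i - Psi (i, sigma i) else rho.
pose v j := V (j, sigma j).
have vb k : (0 < k)%N -> rnorm (v k) <= 2^-1 ^+ k.
  case: k => // k _; have [_ vk _ _] := HV (k.+1, sigma k.+1).
  apply: le_trans vk _ => /=.
  by have [_ _ + _] := HV (k, sigma k).
have fs j : f (rho - sigma j) = iota (series v j).
  rewrite /series /=; elim: j => [|j IH]; first by rewrite subrr big_geq// !linear0.
  rewrite big_nat_recr//= [iota (_ + _)]linearD -IH opprB addrA addrAC linearD; congr (_ + _).
  by have [-> _ _ _] := HV (j, sigma j).
have cv := geometric_series_cvg vb.
exists (limn (series v)).
  have c1 : iota (series v j) @[j --> \oo] --> iota (limn (series v)).
    exact: (cvg_comp _ _ cv (@iota_continuous (limn (series v)))).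
  have c2 : f (rho - sigma j) @[j --> \oo] --> f rho.
    apply: (@cvg_comp _ _ _ (fun j => rho - sigma j) f _ (nbhs rho) _ _ (@f_continuous rho)).
    apply: schwartz_cvg => k s e e0.
    have : (2^-1 ^+ j : R) @[j --> \oo] --> (0 : R).
      by apply: cvg_expr; rewrite ger0_norm// invf_lt1// ltr1n.
    move=> /cvgr0_norm_lt/(_ _ e0)[M _ HM].
    (* The remainder [sigma j.+1] obeys the estimates of step [j], hence the shift by one. *)
    exists (maxn M (pickle (k, s))).+1 => //= j; case: j => // j.
    rewrite [_ j.+1]/= ltnS geq_max => /andP[Mj kj].
    rewrite addrAC subrr add0r seminormN /=.
    have [_ _ _ Hj] := HV (j, sigma j).
    by apply: le_lt_trans (Hj k s kj) _; apply: le_lt_trans (ler_norm _) _; exact: HM.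
  have c3 : f (rho - sigma j) @[j --> \oo] --> iota (limn (series v)).
    by under eq_fun do rewrite fs.
  exact: (cvg_unique hausdorffX c2 c3).
have /cvgr_dist_lt/(_ _ ltr01)[M _ HM] := cv.
have := HM M.+1 (leqnSn M) => /=.
rewrite rnormE -[1 in X in X -> _](rmorph1 (real_complex R)) ltcR => HM1.
rewrite -(subrK (series v M.+1) (limn (series v))).
apply: le_trans (rnormD _ _) _.
have : rnorm (series v M.+1) <= C * P rho + 1.
  rewrite /series /= big_nat_recl//; apply: le_trans (rnormD _ _) _; apply: lerD.
    by have [_ + _ _] := HV (0%N, sigma 0%N).
  apply: le_trans (rnorm_sum _ _) _.
  have := geometric_tail 1 M; rewrite expr1 divff//; apply: le_trans.
  rewrite add1n big_add1 /=; apply: ler_sum => i _; exact: vb.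
by move: HM1; lra.
Qed.

End completion.

Section into_subspace.
Context (R : realType) (X E : lmodType R[i]) (iota : {linear E -> X}).

Lemma intoK : injective iota -> cancel iota (into iota).
Proof.
move=> inj e; apply: inj; rewrite /into.
by have := @xgetPex _ (0 : E) [set v | iota v = iota e] (ex_intro _ e erefl).
Qed.

Lemma intoKV v : range iota v -> iota (into iota v) = v.
Proof.
by move=> [e _ ev]; exact: (@xgetPex _ (0 : E) [set u | iota u = v] (ex_intro _ e ev)).
Qed.

End into_subspace.

(** * Continuity and seminorm bounds *)

Section continuous_linear.
Context (R : realType) (n : nat) (E : normedModType R[i]).
Context (g : {linear schwartz R n -> E}).
Implicit Types (rho phi : schwartz R n).
Notation sn := schwartz_seminorm.

(** A neighbourhood of 0 is mapped into the unit ball, and homogeneity does the rest. The free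
    radius [r] replaces the maximum of the seminorms in [F]. *)
Lemma continuous_linear_bound : continuous g ->
  exists (F : seq (nat * seq 'I_n)) (c : R), 0 < c /\ forall rho (r : R), 0 < r ->
    (forall k s, (k, s) \in F -> sn k s rho < r) -> rnorm (g rho) <= c * r.
Proof.
move=> cg; have /cvgr0_norm_lt/(_ 1 ltr01) : g rho @[rho --> (0 : schwartz R n)] --> (0 : E).
  by rewrite -[X in _ --> X](linear0 g); exact: cg.
move=> [F [e e0 HF]]; exists F, e^-1; split; first by rewrite invr_gt0.
move=> rho r r0 Hr; have er0 : 0 < e / r by rewrite divr_gt0.
have /HF /= : schwartz_ball 0 F e ((e / r)%:C%C *: rho).
  move=> k s ks; rewrite subr0; apply: le_lt_trans (seminormZ_le _ _ _ _) _.
  rewrite normc_real gtr0_norm//.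
  rewrite [ltRHS](_ : e = (e / r) * r); last by rewrite divfK ?gt_eqF.
  by rewrite ltr_pM2l// Hr.
rewrite linearZ/= rnormE -[ltRHS](rmorph1 (real_complex R)) ltcR rnormZ normc_real gtr0_norm// => H.
rewrite mulrC ler_pdivlMr// mulrC.
by move: H; rewrite mulrAC ltr_pdivrMr// mul1r => /ltW.
Qed.

Lemma bound_continuous_linear (F : seq (nat * seq 'I_n)) (c : R) : 0 < c ->
  (forall rho (r : R), 0 < r -> (forall k s, (k, s) \in F -> sn k s rho <= r) ->
    rnorm (g rho) <= c * r) -> continuous g.
Proof.
move=> c0 H rho.
apply/(@cvgrPdist_lt _ _ _ (nbhs rho) (nbhs_filter rho)) => e e0.
have [e1 eE] : 0 < complex.Re e /\ e = (complex.Re e)%:C%C.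
  by move: e0; rewrite ltcE /=; case: e => a b /= /andP[/eqP -> a0].
have r0 : 0 < complex.Re e / 2 / c by rewrite !divr_gt0.
exists F, (complex.Re e / 2 / c) => // psi Hpsi.
rewrite /= distrC -linearB eE rnormE ltcR.
apply: le_lt_trans (H _ _ r0 _) _; first by move=> k s ks; apply/ltW/Hpsi.
by rewrite mulrC divfK ?gt_eqF//; lra.
Qed.

(** Exponents can be raised to common values because wt x >= 1 and 1/y >= 1 on the strip. This gives
    the growth condition (ii) for a continuous [g]. *)
Lemma seminorm_atom_seq phi (F : seq (nat * seq 'I_n)) :
  exists (kappa l : nat) (B : R), 0 < B /\ forall x y, 0 < y <= 1 ->
    forall k s, (k, s) \in F -> sn k s (atom phi (x, y)) < B * (wt x ^+ l / y ^+ kappa).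
Proof.
elim: F => [|[k0 s0] F [kap [l [B [B0 H]]]]]; first by exists 0%N, 0%N, 1.
exists (maxn kap (n + size s0)), (maxn l k0), (B + sn k0 s0 phi); split.
  by rewrite ltr_pwDl// seminorm_ge0.
move=> x y y01 k s; have /andP[y0 y1] := y01.
have V1 : 1 <= y^-1 by rewrite -invr1 lef_pV2 ?posrE.
have V0 : 0 < y^-1 by rewrite invr_gt0.
have mono a b a' b' : (a <= a')%N -> (b <= b')%N ->
    wt x ^+ a * y^-1 ^+ b <= wt x ^+ a' * y^-1 ^+ b'.
  by move=> aa bb; rewrite ler_pM ?wtX_ge0 ?exprn_ge0 ?(ltW V0) ?ler_weXn2l ?wt_ge1.
have pos a b : 0 < wt x ^+ a * y^-1 ^+ b by rewrite mulr_gt0 ?wtX_gt0 ?exprn_gt0.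
rewrite inE -exprVn => /predU1P[[-> ->]|ks].
  apply: le_lt_trans (seminorm_atom _ _ _ _ y01) _.
  rewrite mulrDl; apply: ltr_pwDl; first by rewrite mulr_gt0.
  by rewrite [leRHS]mulrC ler_wpM2r ?seminorm_ge0// mulrC mono ?leq_maxr.
apply: lt_le_trans (H x y y01 k s ks) _; rewrite -exprVn ler_pM ?(ltW B0) ?(ltW (pos _ _))//.
  by rewrite lerDl seminorm_ge0.
by rewrite mono ?leq_maxl.
Qed.

Lemma continuous_atom phi : continuous g ->
  {within @strip R n, continuous (fun p => g (atom phi p))}.
Proof.
move=> cg; apply/subspace_continuousP => -[x y] sp.
have [F [c [c0 H]]] := continuous_linear_bound cg.
apply/cvgrPdist_lt => e e0.
have [e1 eE] : 0 < complex.Re e /\ e = (complex.Re e)%:C%C.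
  by move: e0; rewrite ltcE /=; case: e => a b /= /andP[/eqP -> a0].
pose r := complex.Re e / 2 / c; have r0 : 0 < r by rewrite !divr_gt0.
have [d d0 Hd] := atom_close_seq phi x F sp (divr_gt0 r0 (ltr0n R 2)).
apply/nbhs_ballP; exists d => //= -[x' y'] [/= xx' yy'] sp'.
rewrite distrC -linearB eE rnormE ltcR.
apply: le_lt_trans (H _ _ r0 _) _.
  move=> k s ks; apply: le_lt_trans (Hd _ _ xx' yy' sp' _ _ ks) _.
  by rewrite ltr_pdivrMr// ltr_pMr// ltr1n.
by rewrite mulrC divfK ?gt_eqF//; lra.
Qed.

End continuous_linear.

Theorem theorem7p9 (R : realType) (n : nat) (n_gt0 : (0 < n)%N)
  (X : tvsType R[i]) (hausdorffX : hausdorff_space X)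
  (E : completeNormedModType R[i]) (iota : {linear E -> X})
  (iota_inj : injective iota) (iota_continuous : continuous iota)
  (f : {linear schwartz R n -> X}) (f_continuous : continuous f)
  (phi : schwartz R n) (phi1 : cintegral phi = 1) :
  tempered_in iota f <->
  [/\ ae_strip (fun p => range iota (phi_transform f phi p)),
      strip_measurable (fun p => into iota (phi_transform f phi p))
    & exists (k l : nat) (C : R), 0 < C /\
      ae_strip (fun p => `|into iota (phi_transform f phi p)| <=
        (C * ((1 + enorm p.1) ^+ l / p.2 ^+ k))%:C%C)].
Proof.
split=> [[g cg fg]|[range_ae _ [kappa [l [C [C0 bound_ae]]]]]].
  have intoE p : into iota (phi_transform f phi p) = g (atom phi p).
    by rewrite /phi_transform fg /= (intoK iota_inj).
  split.
  - by apply: aeW => p _; exists (g (atom phi p)) => //; rewrite /phi_transform fg.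
  (* The transform is itself continuous on the strip, so a constant sequence approximates it. *)
  - exists (fun _ p => g (atom phi p)) => [_|]; first exact: continuous_atom.
    by apply: aeW => p _; rewrite intoE; exact: cvg_cst.
  - have [F [c [c0 Hc]]] := continuous_linear_bound cg.
    have [kappa [l [B [B0 HB]]]] := seminorm_atom_seq phi F.
    exists kappa, l, (c * B); split; first by rewrite mulr_gt0.
    apply: aeW => -[x y] sp; have /andP[y0 y1] := sp.
    rewrite intoE rnormE lecR -mulrA; apply: Hc; last exact: HB.
    by rewrite mulr_gt0// divr_gt0 ?wtX_gt0 ?exprn_gt0.
have good : ae_strip (fun p =>
    reach iota f (C * (wt p.1 ^+ l / p.2 ^+ kappa)) (atom phi p)).
  apply: (@filterS2 _ _ (ae_filter_ringOfSetsType _) _ _ _ _ range_ae bound_ae) => p Hr Hb sp.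
  exists (into iota (phi_transform f phi p)); first by rewrite intoKV//; exact: Hr.
  by have := Hb sp; rewrite rnormE lecR.
have [C' C'0 [j appr]] := near_reach_sobolev (ltW C0) good phi1.
have /choice[g Hg] rho : exists v : E, f rho = iota v /\
    rnorm v <= C' * sobolev (l + 2 * n) j [::] rho + 3.
  have [v fv vb] := lift_bounded hausdorffX iota_continuous f_continuous C'0 appr rho.
  by exists v.
(* [g] comes from choice; it inherits linearity from [f] because [iota] is injective. *)
have glin : linear g.
  move=> a u v; apply: iota_inj; rewrite linearP.
  by rewrite -(Hg _).1 -(Hg u).1 -(Hg v).1 linearP.
pose G : {linear schwartz R n -> E} := HB.pack g (GRing.isLinear.Build _ _ _ _ g glin).
exists G; last by apply/funext => rho; exact: (Hg rho).1.
have [F [c [c0 HF]]] := sobolev_small R (l + 2 * n) j ([::] : seq 'I_n).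
apply: (@bound_continuous_linear _ _ _ G F (C' * c + 3)) => [|rho r r0 Hr].
  by rewrite ltr_wpDl// mulr_ge0.
(* The additive 3 is removed by scaling: the seminorms of rho / r in [F] are at most 1, which yields
   the homogeneous bound (C' c + 3) r. *)
have rV0 : 0 < r^-1 by rewrite invr_gt0.
have [_ H] := Hg (r^-1%:C%C *: rho).
have {}H : r^-1 * rnorm (G rho) <= C' * c + 3.
  have -> : r^-1 * rnorm (G rho) = rnorm (G (r^-1%:C%C *: rho)).
    by rewrite linearZ /= rnormZ normc_real gtr0_norm.
  apply: le_trans H _; rewrite lerD2r ler_wpM2l//.
  rewrite -[leRHS]mulr1; apply: HF => k s ks.
  apply: le_trans (seminormZ_le _ _ _ _) _; rewrite normc_real gtr0_norm//.
  by rewrite mulrC ler_pdivrMr// mul1r Hr.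
by rewrite -ler_pdivrMr// mulrC.
Qed.
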